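(* Let $k$, $k'$, $e$, $\epsilon$, $m$, $n$, $G$, $K$, $X$, $\widetilde{\Lambda}_n^+$ and the matrices $x_\lambda$ be as in the context. Then: (1) The map $\widetilde{\Lambda}_n^+ \to K\backslash X$, $\lambda \mapsto K\cdot x_\lambda$, is surjective. (2) This map is bijective if $m$ is even, or $m=3$, or $e=1$. (3) There are precisely two $G$-orbits in $X$, represented by $x_0=1_m$ and $x_1=\mathrm{Diag}(\pi,1_{m-2},\pi^{-1})$. For $\lambda\in\widetilde{\Lambda}_n^+$, one has $x_\lambda\in G\cdot 1_m$ if and only if $|\lambda|=\sum_{i=1}^n\lambda_i$ is even.
   Context: Let $k$ be a finite extension of $\mathbb{Q}_p$ (a $\mathfrak{p}$-adic field) with ring of integers $\mathcal{O}_k$, prime element $\pi$, residue field of cardinality $q$, and additive valuation $v_\pi$ normalized by $v_\pi(\pi)=1$. Let $k'$ be the unramified quadratic extension of $k$ with ring of integers $\mathcal{O}_{k'}$; write $a\mapsto a^*$ for the nontrivial automorphism of $k'/k$, and for a matrix $a$ over $k'$ let $a^*$ denote its conjugate transpose. Put $e=v_\pi(2)\ge 0$ and fix $\epsilon\in\mathcal{O}_k^\times$ such that $\{1,\frac{1+\sqrt{\epsilon}}{2}\}$ is an $\mathcal{O}_k$-basis of $\mathcal{O}_{k'}$ (so $k'=k(\sqrt\epsilon)$, $(\sqrt\epsilon)^*=-\sqrt\epsilon$ and $v_\pi(1-\epsilon)=2e$). Let $m\ge 2$, $n=\lfloor m/2\rfloor$, and let $j_m$ be the $m\times m$ matrix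 with all anti-diagonal entries $1$ and all other entries $0$. Let $G=\{g\in GL_m(k'): g^*j_mg=j_m\}$, $X=\{x\in G: x^*=x,\ \det(t1_m-xj_m)=\det(t1_m-j_m)\}$, with $G$ acting on $X$ by $g\cdot x=gxg^*$, and $K=G\cap M_m(\mathcal{O}_{k'})$. Let $\widetilde{\Lambda}_n^+=\{\lambda\in\mathbb{Z}^n:\lambda_1\ge\lambda_2\ge\cdots\ge\lambda_n\ge -e\}$. For $\lambda\in\widetilde{\Lambda}_n^+$ define $x_\lambda\in X$ to be the $m\times m$ matrix whose only nonzero entries are: for each $i\le n$ with $\lambda_i\ge 0$, the $(i,i)$-entry $\pi^{\lambda_i}$ and the $(m+1-i,m+1-i)$-entry $\pi^{-\lambda_i}$; for each $i\le n$ with $\lambda_i<0$, the $(i,i)$-entry $\pi^{\lambda_i}(1-\epsilon)$, the $(i,m+1-i)$-entry $-\sqrt{\epsilon}$, the $(m+1-i,i)$-entry $\sqrt\epsilon$ and the $(m+1-i,m+1-i)$-entry $\pi^{-\lambda_i}$; and, if $m$ is odd, the $(n+1,n+1)$-entry $1$. *)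

(* Defs.v *)
From HB Require Import structures.
From mathcomp Require Import all_boot all_order all_algebra all_field.
From mathcomp Require Import classical_sets functions.

Set Implicit Arguments.
Unset Strict Implicit.
Unset Printing Implicit Defensive.

Import Order.TTheory GRing.Theory Num.Theory.
Local Open Scope classical_set_scope.
Local Open Scope ring_scope.

(* Valuations are functions F -> int whose value at 0 is irrelevant; the
   convention v(0) = +oo is built into [val_ge]. *)

Definition val_ge (F : fieldType) (v : F -> int) (N : int) : set F :=
  [set x | x = 0 \/ N <= v x].

Record normalized_valuation (F : fieldType) (v : F -> int) : Prop := {
  valM : forall x y, x != 0 -> y != 0 -> v (x * y) = v x + v y;
  valD : forall N x y, val_ge v N x -> val_ge v N y -> val_ge v N (x + y);
  val_norm : exists2 x, x != 0 & v x = 1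
}.

Definition integers (F : fieldType) (v : F -> int) : set F := val_ge v 0.

Definition prime_element (F : fieldType) (v : F -> int) (x : F) : Prop :=
  x != 0 /\ v x = 1.

Definition integer_unit (F : fieldType) (v : F -> int) (x : F) : Prop :=
  x != 0 /\ v x = 0.

Definition val_cauchy (F : fieldType) (v : F -> int) (u : nat -> F) : Prop :=
  forall N, exists n0 : nat,
    forall i j : nat, (n0 <= i)%N -> (n0 <= j)%N -> val_ge v N (u i - u j).

Definition val_cvg (F : fieldType) (v : F -> int) (u : nat -> F) (l : F) :
    Prop :=
  forall N, exists n0 : nat,
    forall i : nat, (n0 <= i)%N -> val_ge v N (u i - l).

Definition rat_val (p : nat) (x : rat) : int :=
  (logn p `|numq x|%N)%:Z - (logn p `|denq x|%N)%:Z.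

(* (F, v) is the field Q_p with its valuation v_p, i.e. the completion of Q for
   the p-adic valuation; this determines (F, v) up to unique isomorphism. *)
Record is_Qp (p : nat) (F : fieldType) (v : F -> int) : Prop := {
  Qp_prime : prime p;
  Qp_val : normalized_valuation v;
  Qp_rat : forall x : rat, x != 0 ->
    (ratr x : F) != 0 /\ v (ratr x) = rat_val p x;
  Qp_dense : forall (x : F) (N : int), exists y : rat, val_ge v N (x - ratr y);
  Qp_complete : forall u, val_cauchy v u -> exists l, val_cvg v u l
}.

(* v' extends v up to normalization, with ramification index r. *)
Definition ramification_index (F : fieldType) (L : fieldExtType F)
    (v : F -> int) (v' : L -> int) (r : nat) : Prop :=
  (0 < r)%N /\ forall x, x != 0 -> v' x%:A = r%:Z * v x.

Definition unramified_quadratic (F : fieldType) (L : fieldExtType F)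
    (v : F -> int) (v' : L -> int) : Prop :=
  \dim {:L} = 2%N /\ ramification_index v v' 1.

Definition nontrivial_automorphism (F : fieldType) (L : fieldExtType F)
    (sigma : {lrmorphism L -> L}) : Prop :=
  bijective sigma /\ exists x, sigma x <> x.

Definition integral_basis2 (F : fieldType) (L : fieldExtType F)
    (v : F -> int) (v' : L -> int) (b1 b2 : L) : Prop :=
  integers v' b1 /\ integers v' b2 /\
  forall x, integers v' x ->
    exists! c : F * F, [/\ integers v c.1, integers v c.2
                         & x = c.1 *: b1 + c.2 *: b2].

Section UnitaryHermitian.
Variables (k : fieldType) (k' : fieldExtType k) (sigma : {lrmorphism k' -> k'}).
Variable m : nat.

Definition antidiag : 'M[k']_m := \matrix_(i, j) (j == rev_ord i)%:R.

Definition conj_tr (a : 'M[k']_m) : 'M[k']_m := map_mx sigma a^T.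

Definition unitary_group : set 'M[k']_m :=
  [set g | g \in unitmx /\ conj_tr g *m antidiag *m g = antidiag].

Definition herm_space : set 'M[k']_m :=
  [set x | [/\ unitary_group x, conj_tr x = x
             & char_poly (x *m antidiag) = char_poly antidiag]].

Definition integral_unitary_group (v' : k' -> int) : set 'M[k']_m :=
  unitary_group `&` [set g | forall i j, integers v' (g i j)].

Definition orbit_of (H : set 'M[k']_m) (x : 'M[k']_m) : set 'M[k']_m :=
  [set g *m x *m conj_tr g | g in H].

Definition orbit_space (H : set 'M[k']_m) : set (set 'M[k']_m) :=
  [set orbit_of H x | x in herm_space].

Definition Lambda (e : int) : set {ffun 'I_m./2 -> int} :=
  [set l | (forall a b : 'I_m./2, (a <= b)%N -> l b <= l a) /\
           forall a, - e <= l a].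

Lemma leq_half_self : (m./2 <= m)%N.
Proof. by rewrite -{2}(odd_double_half m) -addnn addnA leq_addl. Qed.

(* With indices counted from 0, the 1-based index pair (i, m+1-i) becomes
   (lo a, hi a) for a = i-1. *)
Definition lo (a : 'I_m./2) : 'I_m := widen_ord leq_half_self a.
Definition hi (a : 'I_m./2) : 'I_m := rev_ord (lo a).

Definition x_block (pi eps : k) (sqrt_eps : k') (a : 'I_m./2) (z : int) :
    'M[k']_m :=
  if 0 <= z then
    (pi ^ z)%:A *: delta_mx (lo a) (lo a)
    + (pi ^ (- z))%:A *: delta_mx (hi a) (hi a)
  else
    (pi ^ z * (1 - eps))%:A *: delta_mx (lo a) (lo a)
    - sqrt_eps *: delta_mx (lo a) (hi a)
    + sqrt_eps *: delta_mx (hi a) (lo a)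
    + (pi ^ (- z))%:A *: delta_mx (hi a) (hi a).

Definition x_middle : 'M[k']_m :=
  \matrix_(i, j) [&& odd m, val i == m./2 & val j == m./2]%:R.

Definition x_lambda (pi eps : k) (sqrt_eps : k') (l : {ffun 'I_m./2 -> int}) :
    'M[k']_m :=
  \sum_a x_block pi eps sqrt_eps a (l a) + x_middle.

Definition x_one (pi : k) : 'M[k']_m :=
  diag_mx (\row_i (if val i == 0%N then pi%:A
                   else if val i == m.-1 then (pi^-1)%:A else 1)).

End UnitaryHermitian.
Arguments antidiag {k} k' m.
Arguments x_middle {k} k' m.
Arguments x_one {k} k' m pi.

(* Main.v *)
(* With s := x j, the space X is the set of involutions s of the hermitian lattice
   L = O'^m, with form h(y, z) = y^* j z, whose (-1)-eigenspace has dimension n, and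
   K acts on them as the unitary group of L.

   Invariants: x_lambda - j = C diag(pi^-lambda) C^* with C integral containing an
   identity block, so x_mu = g x_lambda g^* yields
   P diag(pi^-lambda) P^* = diag(pi^-mu) with P integral if g is.  Comparing
   elementary divisors recovers lambda from the K-orbit; comparing determinants
   recovers the parity of |lambda| from the G-orbit.

   Surjectivity: take v in L with h(v, (1 - s) v) of minimal valuation l.  One has
   l <= e because 1 - s acts as 2 on its image.  Since unit norms are surjective and
   units congruent to 1 modulo pi^i are norms of such units, v can be corrected to an
   isotropic integral vector x with h(x, s x) = pi^l; then x and s x span an s-stable
   plane on which s acts through the block of lambda = - l, and one proceeds in its
   orthogonal complement.  Starting with the smallest l makes lambda decreasing.

   For G-orbits only the diagonal hermitian form diag(pi^-lambda) matters, and
   (lambda_0, lambda_a) can be replaced by (lambda_0 + lambda_a, 0). *)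

(* When the residue characteristic is 2, [s] need not be diagonalizable over the integers; the
   obstacle is to split off [s]-stable planes without dividing by 2. An element of trace 1 replaces
   one half whenever a hermitian form is polarized. The vectors [x] and [s x] have Gram determinant
   [- pi ^ (2 l)], but [x] and [pi ^ (- l) (x - s x)] generate a unimodular lattice in their plane:
   they are integral, pair to [- 1], and the second has value [- 2 pi ^ (- l)], which is integral
   because [l <= e]. Hence the orthogonal projection onto the plane is integral and splits the
   lattice. Correcting a vector by a norm of units near 1 works only for [l < e]. At [l = e] both
   [1 - s] and [1 + s] are divisible by 2, and the isotropic vector is assembled from one vector of
   each eigenspace. The square root of [eps] enters through two properties. Its conjugate is its
   opposite, which makes the second basis vector [pi ^ lambda (s x + sqrt_eps x)] of a plane
   isotropic. And [1 + sqrt_eps] has valuation [e], which makes that vector integral down to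
   [lambda = - e]. *)
Require Import Defs.
From HB Require Import structures.
From mathcomp Require Import all_boot all_order all_algebra all_field.
From mathcomp Require Import classical_sets functions boolp.
From mathcomp Require Import zify ring.

Set Implicit Arguments.
Unset Strict Implicit.
Unset Printing Implicit Defensive.

Import Order.TTheory GRing.Theory Num.Theory.
Local Open Scope ring_scope.

(** * Discrete valuations *)

Section Valuation.

Variables (F : fieldType) (v : F -> int).
Hypothesis hv : normalized_valuation v.

Lemma val1 : v 1 = 0.
Proof.
have : v 1 = v 1 + v 1 by rewrite -(Defs.valM hv) ?mulr1 ?oner_neq0.
lia.
Qed.

Lemma valN1 : v (-1) = 0.
Proof.
have n0 : (-1 : F) != 0 by rewrite oppr_eq0 oner_neq0.
have : v (-1) + v (-1) = 0 by rewrite -(Defs.valM hv) // mulrNN mulr1 val1.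
lia.
Qed.

Lemma valN x : v (- x) = v x.
Proof.
have [->|x0] := eqVneq x 0; first by rewrite oppr0.
have n0 : (-1 : F) != 0 by rewrite oppr_eq0 oner_neq0.
by rewrite -mulN1r (Defs.valM hv) // valN1 add0r.
Qed.

Lemma valV x : x != 0 -> v x^-1 = - v x.
Proof.
move=> x0; have : v x + v x^-1 = 0.
  by rewrite -(Defs.valM hv) ?invr_eq0 // divff // val1.
lia.
Qed.

Lemma valf_div x y : x != 0 -> y != 0 -> v (x / y) = v x - v y.
Proof. by move=> x0 y0; rewrite (Defs.valM hv) ?invr_eq0 // valV. Qed.

Lemma valX x n : x != 0 -> v (x ^+ n) = n%:Z * v x.
Proof.
move=> x0; elim: n => [|n IH]; first by rewrite expr0 val1 mul0r.
by rewrite exprS (Defs.valM hv) ?expf_neq0 // IH intS mulrDl mul1r.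
Qed.

Lemma valXz x (n : int) : x != 0 -> v (x ^ n) = n * v x.
Proof.
move=> x0; case: n => n; first exact: valX.
by rewrite NegzE -exprnN valV ?expf_neq0 // valX // mulNr.
Qed.

Lemma val_ge0 N : val_ge v N 0.
Proof. by left. Qed.

Lemma val_ge_le N M x : M <= N -> val_ge v N x -> val_ge v M x.
Proof. by move=> le [->|h]; [left|right; apply: le_trans h]. Qed.

Lemma val_geN N x : val_ge v N x -> val_ge v N (- x).
Proof. by move=> [->|h]; [left; rewrite oppr0|right; rewrite valN]. Qed.

Lemma val_geB N x y : val_ge v N x -> val_ge v N y -> val_ge v N (x - y).
Proof. by move=> hx hy; apply: (Defs.valD hv) => //; apply: val_geN. Qed.

Lemma val_geM N M x y : val_ge v N x -> val_ge v M y -> val_ge v (N + M) (x * y).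
Proof.
have [->|x0] := eqVneq x 0; first by rewrite mul0r; left.
have [->|y0] := eqVneq y 0; first by rewrite mulr0; left.
move=> [xz|hx]; first by rewrite xz eqxx in x0.
move=> [yz|hy]; first by rewrite yz eqxx in y0.
by right; rewrite (Defs.valM hv) //; apply: lerD.
Qed.

Lemma val_geMl N x y : val_ge v 0 x -> val_ge v N y -> val_ge v N (x * y).
Proof. by move=> hx hy; rewrite -(add0r N); apply: val_geM. Qed.

Lemma val_geMr N x y : val_ge v N x -> val_ge v 0 y -> val_ge v N (x * y).
Proof. by move=> hx hy; rewrite -(addr0 N); apply: val_geM. Qed.

Lemma val_ge_sum (I : Type) (r : seq I) (P : pred I) (f : I -> F) N :
  (forall i, P i -> val_ge v N (f i)) -> val_ge v N (\sum_(i <- r | P i) f i).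
Proof.
move=> h; elim/big_ind: _ => //; first exact: val_ge0.
by move=> x y; apply: (Defs.valD hv).
Qed.

Lemma val_ge_val x : val_ge v (v x) x.
Proof. by right. Qed.

Lemma val_ge_eq N x : v x = N -> val_ge v N x.
Proof. by move=> <-; right. Qed.

Lemma val_geE N x : x != 0 -> val_ge v N x -> N <= v x.
Proof. by move=> x0 [xz|//]; rewrite xz eqxx in x0. Qed.

Lemma val_ge_1 : val_ge v 0 1.
Proof. by right; rewrite val1. Qed.

Lemma val_ge_nat n : val_ge v 0 n%:R.
Proof.
elim: n => [|n IH]; first exact: val_ge0.
by rewrite -addn1 natrD; apply: (Defs.valD hv) => //; apply: val_ge_1.
Qed.

Lemma val_ge_int (n : int) : val_ge v 0 n%:~R.
Proof.
case: n => n; first exact: val_ge_nat.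
by rewrite NegzE mulrNz; apply: val_geN; apply: (val_ge_nat n.+1).
Qed.

Lemma valD_lt x y : x != 0 -> val_ge v (v x + 1) y ->
  x + y != 0 /\ v (x + y) = v x.
Proof.
move=> x0 hy.
have nz : x + y != 0.
  apply/eqP => /eqP; rewrite addr_eq0 => /eqP xy.
  have : val_ge v (v x + 1) x by rewrite {2}xy; apply: val_geN.
  by move=> /(val_geE x0) hh; lia.
split=> //.
have h1 : v x <= v (x + y).
  apply: val_geE => //; apply: (Defs.valD hv); first exact: val_ge_val.
  by apply: val_ge_le hy; lia.
have [//|ne] := eqVneq (v (x + y)) (v x).
have : val_ge v (v x + 1) x.
  rewrite -{2}(addrK y x); apply: val_geB => //.
  by right; rewrite lezD1 lt_neqAle eq_sym ne.
by move=> /(val_geE x0) hh; lia.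
Qed.

Lemma val_ge_all0 x : (forall n : nat, val_ge v n x) -> x = 0.
Proof.
move=> h; have [//|x0] := eqVneq x 0.
by have := val_geE x0 (h (`|v x|.+1)%N); lia.
Qed.

Lemma val_ge_scale N M x c : c != 0 -> v c = M ->
  val_ge v N (c * x) -> val_ge v (N - M) x.
Proof.
move=> c0 vc h; rewrite -(mulKf c0 x) addrC.
by apply: val_geM => //; right; rewrite valV // vc.
Qed.

Lemma val_unit_inv x : x != 0 -> v x = 0 -> val_ge v 0 x^-1.
Proof. by move=> x0 vx; right; rewrite valV // vx. Qed.

End Valuation.

(** * Completeness and residue field of a finite extension of Q_p *)

(** Completeness with an explicit rate: the remainder after [n] terms has valuation at least [n], so
    limits can be used without choosing thresholds. *)
Definition series_complete (F : fieldType) (v : F -> int) : Prop :=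
  forall d : nat -> F, (forall n : nat, val_ge v n (d n)) ->
  exists l, forall n : nat, val_ge v n (l - \sum_(i < n) d i).

Lemma val_ge_partial_sums (F : fieldType) (v : F -> int)
    (hv : normalized_valuation v) (d : nat -> F) (b : nat -> nat) :
  {homo b : m n / (m <= n)%N} -> (forall n, val_ge v (b n) (d n)) ->
  forall m n : nat, (n <= m)%N ->
    val_ge v (b n) (\sum_(i < m) d i - \sum_(i < n) d i).
Proof.
move=> bmono hd m n nm; rewrite -!(big_mkord xpredT d).
rewrite (big_cat_nat _ nm) //= addrAC subrr add0r.
rewrite big_nat_cond; apply: val_ge_sum => // i; rewrite andbT => /andP[ni _].
by apply: val_ge_le (hd i); rewrite lez_nat bmono.
Qed.

Section Qp.

Variables (p : nat) (Qp : fieldType) (vp : Qp -> int).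
Hypothesis hQp : is_Qp p vp.

Let hvp := Qp_val hQp.
Let p_pr := Qp_prime hQp.

Lemma Qp_int (n : int) : n != 0 ->
  (n%:~R : Qp) != 0 /\ vp n%:~R = logn p `|n|%N.
Proof.
move=> n0; have nQ : n%:~R != 0 :> rat by rewrite intr_eq0.
have [h1 h2] := Qp_rat hQp nQ.
rewrite ratr_int in h1 h2; split=> //; rewrite h2 /rat_val.
by rewrite numq_int denq_int logn1 subr0.
Qed.

Lemma Qp_nat n : (0 < n)%N -> (n%:R : Qp) != 0 /\ vp n%:R = logn p n.
Proof. by move=> n0; have := @Qp_int n%:Z; rewrite absz_nat; apply; lia. Qed.

Lemma Qp_p : (p%:R : Qp) != 0 /\ vp p%:R = 1.
Proof.
have [h1 h2] := Qp_nat (prime_gt0 p_pr).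
by rewrite h2 logn_prime // eqxx.
Qed.

(** By density [x] is congruent to a rational number, whose denominator is prime to [p] and can be
    inverted modulo [p]. *)
Lemma Zp_residue (x : Qp) : val_ge vp 0 x ->
  exists a : 'I_p, val_ge vp 1 (x - a%:R).
Proof.
move=> hx; have [y hy] := Qp_dense hQp x 1.
have y_int : val_ge vp 0 (ratr y).
  rewrite -[ratr y](subKr x); apply: val_geB => //.
  by apply: val_ge_le hy.
have ratE : ratr y = (numq y)%:~R / (denq y)%:~R :> Qp by [].
have [d0 vd] := Qp_int (denq_neq0 y).
(* If [p] divided the denominator it would be prime to the numerator, and [y] would have negative
   valuation. *)
have dcop : coprime p `|denq y|.
  rewrite prime_coprime //; apply/negP => pd.
  have y0 : y != 0.
    by apply/eqP => y0; move: pd; rewrite y0 dvdn1 => /eqP p1; have := p_pr; rewrite p1.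
  have n0 : numq y != 0 by rewrite numq_eq0.
  have [ry0 vy] := Qp_rat hQp y0.
  have /(val_geE ry0) := y_int; rewrite vy /rat_val.
  have -> : logn p `|numq y| = 0%N.
    apply: logn_coprime; have := coprime_num_den y.
    rewrite coprime_sym; exact: coprime_dvdl.
  have : (0 < logn p `|denq y|)%N by rewrite logn_gt0 mem_primes p_pr pd absz_gt0 denq_neq0.
  lia.
have vd0 : vp (denq y)%:~R = 0 by rewrite vd logn_coprime.
(* [u] is the numerator times a Bezout inverse of the denominator modulo [p]; the digit [a] is its
   remainder. *)
have [u hu] : exists u : int, (p %| (u * denq y - numq y))%Z.
  have [u [v' e]] := Bezoutz p (denq y); exists (v' * numq y).
  have e1 : gcdz p (denq y) = 1 by rewrite /gcdz absz_nat; move: dcop => /eqP ->.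
  rewrite e1 in e.
  have -> : v' * numq y * denq y - numq y = (- (u * numq y)) * p by rewrite -[X in _ - X]mul1r -e; ring.
  by rewrite dvdz_mull.
pose a := `|(u %% p)%Z|%N.
have p0 : (p%:Z != 0) by have := prime_gt0 p_pr; lia.
have aE : a%:Z = (u %% p)%Z by rewrite gez0_abs // modz_ge0.
have ap : (a < p)%N by have := ltz_pmod u (_ : 0 < p%:Z); rewrite -aE; have := prime_gt0 p_pr; lia.
exists (Ordinal ap) => /=.
have [t ht] : exists t : int, numq y - a%:Z * denq y = t * p%:Z.
  have /dvdzP[q hq] := hu; exists (- q + (u %/ p)%Z * denq y).
  have ua : a%:Z = u - (u %/ p)%Z * p%:Z by have := divz_eq u p; rewrite -aE => {1}->; ring.
  have nE : numq y = u * denq y - q * p%:Z by rewrite -hq; ring.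
  by rewrite ua {1}nE; ring.
have -> : x - a%:R = (x - ratr y) + (t * p%:Z)%:~R / (denq y)%:~R.
  rewrite -ht ratE rmorphB rmorphM /= mulrBl mulfK //.
  by rewrite addrA subrK.
apply: (Defs.valD hvp) => //; rewrite rmorphM /=.
apply: (val_geMr hvp); last by apply: val_unit_inv.
apply: (val_geMl hvp); first exact: val_ge_int.
by apply: val_ge_eq; have [] := Qp_p.
Qed.

(** The rate [n %/ r] is the one available for coordinates: an element of valuation [n] in an
    extension of ramification index [r] is divisible by [p ^+ (n %/ r)]. *)
Lemma Qp_series (r : nat) (d : nat -> Qp) : (0 < r)%N ->
  (forall n, val_ge vp (n %/ r)%N (d n)) ->
  exists l, forall n, val_ge vp (n %/ r)%N (l - \sum_(i < n) d i).
Proof.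
move=> r0 hd.
have part := val_ge_partial_sums hvp (@leq_div2r r) hd.
have large (N : int) : exists n0 : nat, forall n, (n0 <= n)%N -> N <= (n %/ r)%N.
  exists (`|N| * r)%N => n hn.
  have : (`|N|%N <= n %/ r)%N by rewrite leq_divRL.
  lia.
have [|l hl] := Qp_complete hQp (u := fun n => \sum_(i < n) d i).
  move=> N; have [n0 hn0] := large N; exists n0 => i j hi hj.
  have [ij|/ltnW ij] := leqP j i.
    by apply: val_ge_le (part _ _ ij); apply: hn0.
  rewrite -opprB; apply: val_geN => //.
  by apply: val_ge_le (part _ _ ij); apply: hn0.
exists l => n.
have [n1 hn1] := hl (n %/ r)%N.
have h1 := hn1 _ (leq_maxl n1 n).
have h2 := part _ _ (leq_maxr n1 n).
set S := \sum_(i < maxn n1 n) _ in h1 h2.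
rewrite -[l](addrNK S) -addrA; apply: (Defs.valD hvp) => //.
by rewrite -opprB; apply: val_geN.
Qed.

Variables (k : fieldExtType Qp) (v : k -> int) (r : nat).
Hypotheses (hv : normalized_valuation v) (hr : ramification_index vp v r).

Let r_gt0 : (0 < r)%N := hr.1.

Lemma val_ge_alg N (a : Qp) : val_ge vp N a -> val_ge v (r%:Z * N) a%:A.
Proof.
have [->|a0] := eqVneq a 0; first by rewrite scale0r; left.
move=> /(val_geE a0) h; right; rewrite (hr.2 _ a0).
by rewrite ler_pM2l // ltz_nat.
Qed.

Lemma val_ge_scale_alg N (a : Qp) x : val_ge vp N a -> val_ge v 0 x ->
  val_ge v (r%:Z * N) (a *: x).
Proof. by move=> ha hx; rewrite -mulr_algl; apply: val_geMr => //; apply: val_ge_alg. Qed.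

Lemma p_in_k : (p%:R : k) != 0 /\ v p%:R = r.
Proof.
have [p0 vpp] := Qp_p.
have pE : (p%:R : k) = (p%:R : Qp)%:A by rewrite scaler_nat.
rewrite pE; split; first by rewrite scaler_eq0 (negPf p0) oner_eq0.
by rewrite (hr.2 _ p0) vpp mulr1.
Qed.

(* Linear independence over F_p of the classes of the x_i modulo p. *)
Definition p_independent t (x : 'I_t -> k) : Prop :=
  (forall i, val_ge v 0 (x i)) /\
  forall a : 'I_t -> Qp, (forall i, val_ge vp 0 (a i)) ->
    val_ge v r (\sum_i a i *: x i) -> forall i, val_ge vp 1 (a i).

(** Independence modulo [p] implies linear independence over [Q_p]: a nontrivial relation divided by
    its coefficient of least valuation is integral, has a coefficient 1, and its sum vanishes. *)
Lemma p_independent_dim t (x : 'I_t -> k) : p_independent x ->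
  (t <= \dim {:k})%N.
Proof.
move=> [x_int x_ind].
have /eqP <- : size (mktuple x) == t by rewrite size_tuple.
have fr : free (mktuple x).
  apply/freeP => a ha.
  have [/forallP h i|] := boolP [forall i, a i == 0]; first exact/eqP.
  rewrite negb_forall => /existsP[i1 hi1].
  case: (@arg_minP _ _ _ i1 (fun i => a i != 0) (fun i => vp (a i)) hi1) => i0 hi0 i0min.
  have := x_ind (fun i => a i / a i0) _ _ i0; rewrite divff //.
  case=> [i||/eqP|]; rewrite ?oner_eq0 ?(val1 hvp) //.
  - have [->|ai0] := eqVneq (a i) 0; first by rewrite mul0r; left.
    by right; rewrite (valf_div hvp) // subr_ge0 i0min.
  - suff -> : \sum_i (a i / a i0) *: x i = 0 by left.
    transitivity ((a i0)^-1 *: \sum_i a i *: (mktuple x)`_i); last by rewrite ha scaler0.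
    by rewrite scaler_sumr; apply: eq_bigr => i _; rewrite scalerA mulrC nth_mktuple.
by move/eqP: fr => <-; apply: dimvS; apply: subvf.
Qed.

(** A [p]-independent family of maximal size works; the dimension bounds these sizes. If [y] were
    not generated modulo [p], adjoining it would give a larger family, since a relation in which [y]
    has a unit coefficient can be solved for [y]. *)
Lemma p_generators : exists t, exists2 x : 'I_t -> k,
  (forall i, val_ge v 0 (x i)) &
  forall y, val_ge v 0 y -> exists2 a : 'I_t -> Qp,
    (forall i, val_ge vp 0 (a i)) & val_ge v r (y - \sum_i a i *: x i).
Proof.
pose P t := `[< exists x : 'I_t -> k, p_independent x >].
have exP : exists t, P t.
  exists 0%N; apply/asboolP; exists (fun=> 0); split=> [|a _ _]; last by case.
  by move=> i; left.
have ubP t : P t -> (t <= \dim {:k})%N by move=> /asboolP[x]; apply: p_independent_dim.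
case: (ex_maxnP exP ubP) => t /asboolP[x [x_int x_ind]] tmax.
exists t; exists x => // y hy.
apply: contrapT => no.
suff : P t.+1 by move=> /tmax; rewrite ltnn.
apply/asboolP; exists (fun i => if unlift ord0 i is Some j then x j else y).
split=> [i|a a_int]; first by case: unliftP.
rewrite big_ord_recl unlift_none.
under eq_bigr do rewrite liftK.
move=> ha.
have [a0p|a0u] := pselect (val_ge vp 1 (a ord0)).
  have h i : val_ge vp 1 (a (lift ord0 i)).
    move: i; apply: x_ind => [i|]; first exact: a_int.
    have -> : \sum_i a (lift ord0 i) *: x i =
      (a ord0 *: y + \sum_i a (lift ord0 i) *: x i) - a ord0 *: y by rewrite addrC addKr.
    apply: val_geB => //.
    by rewrite -[r%:Z]mulr1; apply: val_ge_scale_alg.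
  by move=> i; case: (unliftP ord0 i) => [j|] ->.
have a00 : a ord0 != 0 by apply/eqP => a0; apply: a0u; left.
have va0 : vp (a ord0) = 0.
  have := val_geE a00 (a_int ord0).
  have : ~ (1 <= vp (a ord0)) by move=> ?; apply: a0u; right.
  lia.
case: no; exists (fun i => - (a ord0)^-1 * a (lift ord0 i)).
  move=> i; apply: (val_geMl hvp) => //; apply: (val_geN hvp).
  exact: (val_unit_inv hvp).
have -> : y - \sum_i (- (a ord0)^-1 * a (lift ord0 i)) *: x i =
    (a ord0)^-1 *: (a ord0 *: y + \sum_i a (lift ord0 i) *: x i).
  rewrite scalerDr scalerA mulVf // scale1r scaler_sumr -sumrN; congr (_ + _).
  by apply: eq_bigr => i _; rewrite mulNr scaleNr opprK scalerA.
rewrite -mulr_algl; apply: (val_geMl hv) => //.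
rewrite -(mulr0 r%:Z); apply: val_ge_alg; exact: (val_unit_inv hvp).
Qed.

(** Successive approximation, as in Nakayama's lemma: an integer is a combination of the generators
    plus [p] times another integer, and iterating on the remainder expands each coordinate as a
    [p]-adic series. *)
Lemma integers_generators : exists t, exists2 x : 'I_t -> k,
  (forall i, val_ge v 0 (x i)) &
  forall y, val_ge v 0 y -> exists2 a : 'I_t -> Qp,
    (forall i, val_ge vp 0 (a i)) & y = \sum_i a i *: x i.
Proof.
have [t [x x_int gen]] := p_generators.
have [p0 vpr] := p_in_k.
exists t; exists x => // y0 hy0.
(* The default value for non-integral [y] makes the step a total function, so that choice applies
   and the step can be iterated. *)
have step y : exists aR : ('I_t -> Qp) * k, val_ge v 0 y ->
    [/\ forall i, val_ge vp 0 (aR.1 i), val_ge v 0 aR.2 &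
        y = \sum_i aR.1 i *: x i + p%:R * aR.2].
  have [hy|] := pselect (val_ge v 0 y); last by exists (fun=> 0, 0).
  have [a a_int ha] := gen y hy.
  exists (a, p%:R^-1 * (y - \sum_i a i *: x i)) => _; split=> //=.
    rewrite -(subrr r%:Z) addrC; apply: (val_geM hv) => //.
    by right; rewrite valV // vpr.
  by rewrite mulVKf // addrC subrK.
have [f hf] := choice step.
pose ys j := iter j (fun y => (f y).2) y0.
have ys_int j : val_ge v 0 (ys j) by elim: j => //= j /hf[].
pose d i j := p%:R ^+ j * (f (ys j)).1 i.
have [p0' vpp] := Qp_p.
have hd i j : val_ge vp (j %/ 1)%N (d i j).
  rewrite divn1; apply: (val_geMr hvp); last by have [] := hf _ (ys_int j).
  by apply: val_ge_eq; rewrite (valX hvp) // vpp mulr1.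
have [l hl] := choice (fun i => Qp_series (ltn0Sn 0) (hd i)).
exists l => [i|].
  by have := hl i 0%N; rewrite big_ord0 subr0 divn1.
have rem n : y0 = \sum_i (\sum_(j < n) d i j) *: x i + p%:R ^+ n * ys n.
  elim: n => [|n IH].
    rewrite expr0 mul1r big1 ?add0r // => i _.
    by rewrite big_ord0 scale0r.
  rewrite {1}IH; have [_ _ {1}->] := hf _ (ys_int n).
  rewrite mulrDr mulrA -exprSr addrA; congr (_ + _).
  rewrite mulr_sumr -big_split; apply: eq_bigr => i _ /=.
  rewrite big_ord_recr /= scalerDl; congr (_ + _).
  have pE : (p%:R : k) = (p%:R : Qp)%:A by rewrite scaler_nat.
  by rewrite /d -scalerA pE -(rmorphXn (in_alg k)) /= mulr_algl.
apply/eqP; rewrite -subr_eq0; apply/eqP; apply: (val_ge_all0 (v := v)) => n.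
have -> : y0 - \sum_i l i *: x i = p%:R ^+ n * ys n - \sum_i (l i - \sum_(j < n) d i j) *: x i.
  rewrite {1}(rem n).
  under [in RHS]eq_bigr do rewrite scalerBl.
  by rewrite sumrB opprB addrA [RHS]addrAC [in RHS]addrC addrA.
have rn : n%:Z <= r%:Z * n%:Z by rewrite -PoszM lez_nat leq_pmull.
apply: (val_geB hv).
  apply: (val_geMr hv) => //; right; rewrite (valX hv) // vpr; lia.
apply: (val_ge_sum hv) => i _.
apply: val_ge_le rn _; apply: val_ge_scale_alg => //.
by have := hl i n; rewrite divn1.
Qed.

(** The series is summed coordinate by coordinate over the integral generators. The coordinates of
    [d n] can be taken divisible by [p ^+ (n %/ r)]. *)
Lemma finite_extension_complete : series_complete v.
Proof.
move=> d hd.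
have [t [x x_int gen]] := integers_generators.
have [p0 vpr] := p_in_k; have [p0' vpp] := Qp_p.
have coords n : exists c : 'I_t -> Qp,
    (forall i, val_ge vp (n %/ r)%N (c i)) /\ d n = \sum_i c i *: x i.
  have hdn : val_ge v 0 (d n / p%:R ^+ (n %/ r)).
    rewrite -(subrr n%:Z); apply: (val_geM hv) => //.
    right; rewrite valV ?expf_neq0 // (valX hv) // vpr.
    by have := leq_trunc_div n r; lia.
  have [a a_int ha] := gen _ hdn.
  exists (fun i => p%:R ^+ (n %/ r) * a i); split=> [i|].
    apply: (val_geMr hvp) => //.
    by apply: val_ge_eq; rewrite (valX hvp) // vpp mulr1.
  have -> : d n = p%:R ^+ (n %/ r) * (d n / p%:R ^+ (n %/ r)) by rewrite mulrCA divff ?mulr1 // expf_neq0.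
  rewrite ha mulr_sumr; apply: eq_bigr => i _.
  have pE : (p%:R : k) = (p%:R : Qp)%:A by rewrite scaler_nat.
  by rewrite -scalerA pE -(rmorphXn (in_alg k)) /= mulr_algl.
have [C hC] := choice coords.
have [l hl] := choice (fun i => Qp_series r_gt0 (fun n => (hC n).1 i)).
exists (\sum_i l i *: x i) => n.
have lim m : val_ge v (r%:Z * (m %/ r)%N) (\sum_i l i *: x i - \sum_(j < m) d j).
  have -> : \sum_i l i *: x i - \sum_(j < m) d j = \sum_i (l i - \sum_(j < m) C j i) *: x i.
    under [in RHS]eq_bigr do rewrite scalerBl scaler_suml.
    rewrite sumrB exchange_big /=; congr (_ - _).
    by apply: eq_bigr => j _; rewrite (hC j).2.
  by apply: (val_ge_sum hv) => i _; apply: val_ge_scale_alg.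
(* Rounding may make [r * (n %/ r)] smaller than [n]; the partial sum of length [n + r] restores the
   required precision. *)
have h1 := lim (n + r)%N.
have h2 := val_ge_partial_sums hv (fun _ _ h => h) hd (leq_addr r n).
set S := \sum_(i < n + r) _ in h1 h2.
rewrite -[X in X - _](addrNK S) -addrA; apply: (Defs.valD hv) => //.
apply: val_ge_le h1; have := divn_eq (n + r) r.
by have := ltn_pmod (n + r) r_gt0; lia.
Qed.

(** Combinations of the generators with digits below [p] represent all integers modulo [p], hence
    modulo the maximal ideal. They may repeat classes, and only finiteness is claimed. *)
Lemma finite_residue_field : exists T : finType, exists rep : T -> k,
  forall y, val_ge v 0 y -> exists t, val_ge v 1 (y - rep t).
Proof.
have [t [x x_int gen]] := p_generators.
exists {ffun 'I_t -> 'I_p}, (fun f : {ffun 'I_t -> 'I_p} => \sum_i (f i)%:R *: x i) => y hy.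
have [a a_int ha] := gen y hy.
have [b hb] := choice (fun i => Zp_residue (a_int i)).
exists [ffun i => b i].
have r1 : 1 <= r%:Z by rewrite lez_nat.
have -> : y - \sum_i ([ffun i => b i] i)%:R *: x i = (y - \sum_i a i *: x i) +
    \sum_i (a i - (b i)%:R) *: x i.
  under [X in _ = _ + X]eq_bigr do rewrite scalerBl.
  rewrite sumrB addrA subrK; congr (_ - _).
  by apply: eq_bigr => i _; rewrite ffunE.
apply: (val_ge_le r1); apply: (Defs.valD hv) => //.
apply: (val_ge_sum hv) => i _; rewrite -(mulr1 r%:Z).
exact: val_ge_scale_alg.
Qed.

End Qp.

(** * Norms from the unramified quadratic extension *)

(** The pigeonhole argument for representing elements of a finite field by [a ^+ 2 - c * b ^+ 2].
    Fibers have at most two points, and the one through the fixed point [z] of [opp] has only one,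
    so each image fills more than half of [A]. Characteristic 2, where [opp] is the identity, is
    covered as well. *)
Lemma fibers_of_two_collide (T : finType) (A : {set T}) (f g opp : T -> T) (z : T) :
  z \in A -> opp z = z ->
  (forall x, x \in A -> f x \in A) -> (forall x, x \in A -> g x \in A) ->
  {in A &, forall x y, f x = f y -> y = x \/ y = opp x} ->
  {in A &, forall x y, g x = g y -> y = x \/ y = opp x} ->
  exists x y, [/\ x \in A, y \in A & f x = g y].
Proof.
move=> zA oz fA gA ff gg.
have card (h : T -> T) : {in A &, forall x y, h x = h y -> y = x \/ y = opp x} ->
    (#|A| < 2 * #|h @: A|)%N.
  move=> hh; rewrite -sum1_card (partition_big_imset h) /=.
  have zi : h z \in h @: A by apply: imset_f.
  rewrite (bigD1 (h z)) //= (cardsD1 (h z)) zi mulnDr muln1 -addn1 [X in (_ <= X)%N]addnC.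
  have -> : (\sum_(i in A | h i == h z) 1 = 1)%N.
    rewrite (bigD1 z) /= ?zA ?eqxx // big1 // => i /andP[/andP[iA /eqP hi] iz].
    have [e|e] := hh _ _ zA iA (esym hi); first by rewrite e eqxx in iz.
    by rewrite e oz eqxx in iz.
  rewrite addnAC addnC leq_add2r.
  rewrite mulnC -sum_nat_const.
  under [X in (_ <= X)%N]eq_bigl do rewrite in_setD1 andbC.
  apply: leq_sum => u /andP[/imsetP[x xA ->] _].
  rewrite sum1_card.
  apply: (@leq_trans #|[set x; opp x]|); last by rewrite cards2; case: (_ != _).
  apply/subset_leq_card/fintype.subsetP => y; rewrite unfold_in => /andP[yA /eqP hy].
  by rewrite !inE; have [->|->] := hh _ _ xA yA (esym hy); rewrite eqxx ?orbT.
have := card _ ff; have := card _ gg => cg cf.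
have [/pred0P disj|/pred0Pn[u /andP[/imsetP[x xA ->] /imsetP[y yA e]]]] :=
    boolP [disjoint f @: A & g @: A]; last by exists x, y.
have : (#|f @: A :|: g @: A| <= #|A|)%N.
  apply/subset_leq_card/fintype.subsetP => u; rewrite inE => /orP[] /imsetP[x xA ->].
    exact: fA.
  exact: gA.
have /eqP -> : #|f @: A :|: g @: A| == (#|f @: A| + #|g @: A|)%N.
  by rewrite (leq_card_setU _ _).2; apply/pred0P.
lia.
Qed.

Section Residues.

Variables (k : fieldType) (v : k -> int).
Hypothesis hv : normalized_valuation v.
Hypothesis res_fin : exists T : finType, exists rep : T -> k,
  forall y, val_ge v 0 y -> exists t, val_ge v 1 (y - rep t).

(** The residue field as a bare set of labels [A] with a reduction map and a section: counting needs
    no field structure on it. *)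
Lemma residue_classes : exists (T : finType) (A : {set T}) (rep : T -> k) (red : k -> T),
  [/\ forall x, val_ge v 0 x -> red x \in A,
      forall t, t \in A -> val_ge v 0 (rep t) /\ red (rep t) = t &
      forall x y, val_ge v 0 x -> val_ge v 0 y ->
        (red x = red y <-> val_ge v 1 (x - y))].
Proof.
have [T [rep hrep]] := res_fin.
(* A class may have several representatives. [pick] depends only on the predicate, which congruent
   integers share, so they receive the same label. *)
pose red x := [pick t | `[< val_ge v 1 (x - rep t) >]].
have redP x : val_ge v 0 x -> exists2 t, red x = Some t & val_ge v 1 (x - rep t).
  move=> hx; rewrite /red; case: pickP => [t /asboolP ht|no]; first by exists t.
  have [t ht] := hrep x hx.
  by have := no t; rewrite asboolT.
pose A := [set o : option T | `[< exists2 x, val_ge v 0 x & red x = o >]].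
have [rep' hrep'] : exists rep' : option T -> k,
    forall o, o \in A -> val_ge v 0 (rep' o) /\ red (rep' o) = o.
  suff /choice[r hr] o : exists x, o \in A -> val_ge v 0 x /\ red x = o by exists r.
  have [|no] := boolP (o \in A); last by exists 0.
  by rewrite inE => /asboolP[x hx <-]; exists x.
exists (option T), A, rep', red; split=> //.
- by move=> x hx; rewrite inE; apply/asboolP; exists x.
- move=> x y hx hy; split=> [e|xy].
    have [t tx ht] := redP x hx; have [t' ty ht'] := redP y hy.
    move: e; rewrite tx ty => -[e]; rewrite -e in ht'.
    by rewrite -(subrKA (rep t)); apply: (Defs.valD hv) => //; rewrite -opprB; apply: val_geN.
  apply: eq_pick => t; apply: asbool_equiv_eq; split=> h.
    by rewrite -(subrKA x); apply: (Defs.valD hv) => //; rewrite -opprB; apply: val_geN.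
  by rewrite -(subrKA y); apply: (Defs.valD hv).
Qed.

Lemma val_ge1M x y : val_ge v 0 x -> val_ge v 0 y -> val_ge v 1 (x * y) ->
  val_ge v 1 x \/ val_ge v 1 y.
Proof.
have [->|x0] := eqVneq x 0; first by left; left.
have [->|y0] := eqVneq y 0; first by right; left.
move=> /(val_geE x0) hx /(val_geE y0) hy /(val_geE (mulf_neq0 x0 y0)).
rewrite (Defs.valM hv) // => h.
have [h1|h1] := leP 1 (v x); first by left; right.
right; right; lia.
Qed.

(** Modulo the maximal ideal the maps [a ^+ 2] and [c * b ^+ 2 + u] both identify only opposite
    elements, so their images meet. With [c = eps] the form is the norm from [k']. *)
Lemma binary_form_mod u c : v c = 0 -> c != 0 -> val_ge v 0 u ->
  exists a b, [/\ val_ge v 0 a, val_ge v 0 b & val_ge v 1 (a ^+ 2 - c * b ^+ 2 - u)].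
Proof.
move=> vc c0 hu; have [T [A [rep [red [redA repA redE]]]]] := residue_classes.
have sq x : val_ge v 0 x -> val_ge v 0 (x ^+ 2) by move=> hx; rewrite expr2; apply: val_geMl.
have hc : val_ge v 0 c by right; rewrite vc.
have aff x : val_ge v 0 x -> val_ge v 0 (c * x ^+ 2 + u).
  by move=> hx; apply: (Defs.valD hv) => //; apply: (val_geMl hv) => //; apply: sq.
pose f t := red (rep t ^+ 2); pose g t := red (c * rep t ^+ 2 + u).
pose opp t := red (- rep t).
have fib x y : x \in A -> y \in A -> val_ge v 1 (rep x ^+ 2 - rep y ^+ 2) ->
    y = x \/ y = opp x.
  move=> /repA[hx ex] /repA[hy ey]; rewrite subr_sqr => /val_ge1M[|||h].
  - exact: val_geB.
  - exact: (Defs.valD hv).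
  - by move=> /redE h; left; rewrite -ex -ey h.
  - right; rewrite -ey; apply/redE => //; first exact: val_geN.
    by rewrite opprK addrC.
have zA : red 0 \in A by apply: redA; left.
have [hz ez] := repA _ zA.
have oz : opp (red 0) = red 0.
  have /redE h := ez; apply/redE; [exact: val_geN|by left|].
  by rewrite subr0; apply: (val_geN hv); rewrite -[rep _]subr0; apply: h => //; left.
have fA t : t \in A -> f t \in A by move=> /repA[h _]; apply: redA; apply: sq.
have gA t : t \in A -> g t \in A by move=> /repA[h _]; apply: redA; apply: aff.
have ff : {in A &, forall x y, f x = f y -> y = x \/ y = opp x}.
  move=> x y xA yA /redE h; apply: fib => //; have [hx _] := repA x xA; have [hy _] := repA y yA.
  by apply: h; apply: sq.
have gg : {in A &, forall x y, g x = g y -> y = x \/ y = opp x}.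
  move=> x y xA yA /redE h; apply: fib => //; have [hx _] := repA x xA; have [hy _] := repA y yA.
  rewrite -(subr0 1); apply: (val_ge_scale hv c0 vc).
  have -> : c * (rep x ^+ 2 - rep y ^+ 2) = c * rep x ^+ 2 + u - (c * rep y ^+ 2 + u) by ring.
  by apply: h; apply: aff.
have [t [t' [/repA[ht _] /repA[ht' _] /redE h]]] := fibers_of_two_collide zA oz fA gA ff gg.
exists (rep t), (rep t'); split=> //.
by rewrite -addrA -opprD; apply: h; [apply: sq|apply: aff].
Qed.

End Residues.

(** All that the lattice theory uses about [k'] over [k]: [w] is a prime element coming from [k],
    and [theta] is the square root of [eps]. [ui_trace] replaces division by 2, while [ui_norm] and
    [ui_norm1] are the two norm theorems for units. *)
Record unramified_involution (F : fieldType) (sigma : {rmorphism F -> F})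
    (v : F -> int) (w theta : F) : Prop := {
  ui_val : normalized_valuation v;
  ui_inv : forall x, sigma (sigma x) = x;
  ui_val_sigma : forall x, v (sigma x) = v x;
  ui_w0 : w != 0;
  ui_vw : v w = 1;
  ui_sw : sigma w = w;
  ui_stheta : sigma theta = - theta;
  ui_theta0 : 1 + theta != 0;
  ui_vtheta : v (1 + theta) = v 2%:R;
  ui_char0 : forall n, n.+1%:R != 0 :> F;
  ui_trace : exists2 omega, val_ge v 0 omega & omega + sigma omega = 1;
  ui_norm : forall u, u != 0 -> v u = 0 -> sigma u = u ->
    exists z, [/\ z != 0, v z = 0 & z * sigma z = u];
  ui_norm1 : forall (i : nat) u, (0 < i)%N -> sigma u = u -> val_ge v i (u - 1) ->
    exists2 y, val_ge v i (y - 1) & y * sigma y = u }.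

Section Unramified.

Variables (k : fieldType) (v : k -> int) (hv : normalized_valuation v).
Hypothesis k_complete : series_complete v.
Hypothesis res_fin : exists T : finType, exists rep : T -> k,
  forall y, val_ge v 0 y -> exists t, val_ge v 1 (y - rep t).
Hypothesis k_char0 : forall n, n.+1%:R != 0 :> k.
Variables (pi : k) (hpi : prime_element v pi).
Variables (k' : fieldExtType k) (v' : k' -> int) (hv' : normalized_valuation v').
Hypothesis hk' : ramification_index v v' 1.
Variables (sigma : {lrmorphism k' -> k'}) (hsigma : nontrivial_automorphism sigma).
Variables (eps : k) (heps : integer_unit v eps).
Variables (theta : k') (hsqrt : theta ^+ 2 = eps%:A).
Let omega := (1 + theta) / 2%:R.
Hypothesis hbasis : integral_basis2 v v' 1 omega.

Let two0 : (2%:R : k') != 0.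
Proof.
have := k_char0 1; rewrite -(fmorph_eq0 (in_alg k')) /=.
by rewrite scaler_nat.
Qed.

Let alg_eq0 (a : k) : (a%:A == 0 :> k') = (a == 0).
Proof. by rewrite -(fmorph_eq0 (in_alg k')). Qed.

Let val_alg (a : k) : v' a%:A = v a \/ a = 0.
Proof.
have [->|a0] := eqVneq a 0; [by right|left].
by rewrite (hk'.2 _ a0) mul1r.
Qed.

Let val_ge_A N (a : k) : val_ge v N a -> val_ge v' N a%:A.
Proof.
move=> [->|h]; first by rewrite scale0r; left.
by have [e|->] := val_alg a; [right; rewrite e|rewrite scale0r; left].
Qed.

Let omega_int : val_ge v' 0 omega.
Proof. by case: hbasis => _ []. Qed.

Let thetaE : theta = 2%:R * omega - 1.
Proof. by rewrite /omega mulrC divfK // addrC addKr. Qed.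

(** The extension is unramified, so [pi] is also a prime element of [k'], and the integral basis can
    be rescaled by [pi ^ N]. *)
Lemma integral_coordinates N (x : k') : val_ge v' N x -> exists a b : k,
  [/\ val_ge v N a, val_ge v N b & x = a%:A + b%:A * omega].
Proof.
move=> hx; have [pi0 vpi] := hpi.
have pA0 : (pi%:A : k') != 0 by rewrite alg_eq0.
have vpA : v' pi%:A = 1 by rewrite (hk'.2 _ pi0) mul1r.
have hy : val_ge v' 0 (pi%:A ^ (- N) * x).
  rewrite -(addNr N); apply: (val_geM hv') => //.
  by right; rewrite (valXz hv') // vpA mulr1.
have [_ [_ /(_ _ hy)[[a b] [[/= ha hb e] _]]]] := hbasis.
exists (pi ^ N * a), (pi ^ N * b).
have vN : val_ge v N (pi ^ N) by right; rewrite (valXz hv) // vpi mulr1.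
split; try exact: (val_geMr hv).
have -> : x = pi%:A ^ N * (pi%:A ^ (- N) * x).
  by rewrite mulrA -expfzDr // subrr expr0z mul1r.
have mA c : (pi ^ N * c)%:A = pi%:A ^ N * c%:A :> k'.
  rewrite -[pi%:A ^ N](fmorphXz (in_alg k') N pi); exact: (rmorphM (in_alg k')).
by rewrite !mA e -(mulr_algl b omega) mulrDr mulrA.
Qed.

Let stheta : sigma theta = - theta.
Proof.
have : sigma theta ^+ 2 = theta ^+ 2 by rewrite -rmorphXn /= hsqrt rmorph_alg.
move/eqP; rewrite eqf_sqr => /orP[/eqP e|/eqP //].
(* If [sigma] fixed [theta] it would fix every [a + b omega], contradicting nontriviality. *)
have [_ [x []]] := hsigma.
have [a [b [_ _ ->]]] := integral_coordinates (val_ge_val v' x).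
by rewrite rmorphD rmorphM /= !rmorph_alg /omega fmorph_div rmorphD rmorph1 rmorph_nat /= e.
Qed.

Let somega : sigma omega = 1 - omega.
Proof.
rewrite /omega fmorph_div rmorphD rmorph1 rmorph_nat /= stheta.
by field.
Qed.

Let sigmaK x : sigma (sigma x) = x.
Proof.
have [a [b [_ _ ->]]] := integral_coordinates (val_ge_val v' x).
rewrite rmorphD rmorphM /= !rmorph_alg somega rmorphD rmorphM /= !rmorph_alg.
by rewrite rmorphB rmorph1 /= somega subKr.
Qed.

Let val_ge_sigma N x : val_ge v' N x -> val_ge v' N (sigma x).
Proof.
move=> /integral_coordinates[a [b [ha hb ->]]].
rewrite rmorphD rmorphM /= !rmorph_alg somega.
apply: (Defs.valD hv'); first exact: val_ge_A.
apply: (val_geMr hv'); first exact: val_ge_A.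
by apply: (val_geB hv') => //; apply: val_ge_1.
Qed.

Let val_sigma x : v' (sigma x) = v' x.
Proof.
have [->|x0] := eqVneq x 0; first by rewrite rmorph0.
have sx0 : sigma x != 0 by rewrite fmorph_eq0.
apply/eqP; rewrite eq_le; apply/andP; split; apply: val_geE => //.
  by rewrite -{2}(sigmaK x); apply: val_ge_sigma; right.
by apply: val_ge_sigma; right.
Qed.

Let theta0 : theta != 0.
Proof.
apply/eqP => t0; have := hsqrt; rewrite t0 expr0n /= => /esym/eqP.
by rewrite alg_eq0 (negPf heps.1).
Qed.

Let val_theta : v' theta = 0.
Proof.
have := valX hv' 2 theta0; rewrite hsqrt (hk'.2 _ heps.1) heps.2 mulr0.
lia.
Qed.

(** [omega] has trace 1, so it cannot lie in the maximal ideal, which [sigma] preserves. As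
    [1 + theta] is twice [omega], this gives the valuation of [1 + theta]. *)
Let omega_unit : omega != 0 /\ v' omega = 0.
Proof.
have no : ~ val_ge v' 1 omega.
  move=> h; have : val_ge v' 1 (omega + sigma omega).
    by apply: (Defs.valD hv') => //; apply: val_ge_sigma.
  rewrite somega addrC subrK => /(val_geE (oner_neq0 _)).
  by rewrite val1.
have o0 : omega != 0 by apply/eqP => o0; apply: no; left.
split=> //; have := val_geE o0 omega_int.
have : ~ (1 <= v' omega) by move=> h; apply: no; right.
lia.
Qed.

Lemma fixed_by_sigma N x : sigma x = x -> val_ge v' N x ->
  exists2 a : k, val_ge v N a & x = a%:A.
Proof.
move=> sx /integral_coordinates[a [b [ha hb e]]]; exists a => //.
have : sigma x - x = 0 by rewrite sx subrr.
rewrite e rmorphD rmorphM /= !rmorph_alg somega => h.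
have : b%:A * theta = 0 by rewrite thetaE -oppr0 -h; ring.
by move/eqP; rewrite mulf_eq0 (negPf theta0) orbF => /eqP ->; rewrite mul0r addr0.
Qed.

Lemma unramified_complete : series_complete v'.
Proof.
move=> d hd.
have co (n : nat) : exists ab : k * k, [/\ val_ge v n ab.1, val_ge v n ab.2 &
    d n = ab.1%:A + ab.2%:A * omega].
  by have [a [b h]] := integral_coordinates (hd n); exists (a, b).
have [f hf] := choice co.
have [|la hla] := k_complete (d := fun n => (f n).1); first by move=> n; have [] := hf n.
have [|lb hlb] := k_complete (d := fun n => (f n).2); first by move=> n; have [] := hf n.
exists (la%:A + lb%:A * omega) => n.
have -> : la%:A + lb%:A * omega - \sum_(i < n) d i =
   (la - \sum_(i < n) (f i).1)%:A + (lb - \sum_(i < n) (f i).2)%:A * omega.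
  rewrite (eq_bigr (fun i : 'I_n => (f i).1%:A + (f i).2%:A * omega)); last first.
    by move=> i _; have [] := hf i.
  rewrite big_split /= -mulr_suml !scalerBl !scaler_suml; ring.
apply: (Defs.valD hv'); first exact: val_ge_A.
by apply: (val_geMr hv') => //; apply: val_ge_A.
Qed.

(** Newton iteration. [rho y] is the relative error of the norm of [y]. Since [omega] has trace 1,
    the norm of [1 + rho * omega] is [1 + rho] up to a multiple of [rho ^+ 2], so multiplying [y] by
    this factor removes the error to first order. *)
Let norm_lift (i : nat) u : (0 < i)%N -> sigma u = u -> val_ge v' i (u - 1) ->
  exists2 y, val_ge v' i (y - 1) & y * sigma y = u.
Proof.
move=> i0 su hu.
pose rho y := u / (y * sigma y) - 1.
pose next y := y * (1 + rho y * omega).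
pose ys n := iter n next 1.
have near1 N x : 0 < N -> val_ge v' N (x - 1) -> x != 0 /\ v' x = 0.
  move=> N0 hx; have := valD_lt hv' (oner_neq0 _) (y := x - 1).
  rewrite (val1 hv') add0r [1 + _]addrC subrK; apply; apply: val_ge_le hx; lia.
have srho y : sigma (rho y) = rho y.
  by rewrite /rho rmorphB fmorph_div rmorphM /= sigmaK su rmorph1 [y * _]mulrC.
have step n : [/\ ys n != 0, v' (ys n) = 0 & val_ge v' (i + n)%N (rho (ys n))].
  elim: n => [|n [y0 vy hr]].
    rewrite /ys /= oner_neq0 (val1 hv') /rho rmorph1 mulr1 divr1 addn0.
    by split.
  have iN : 0 < (i + n)%N%:Z by lia.
  have r_om : val_ge v' (i + n)%N (rho (ys n) * omega) by apply: val_geMr.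
  have [c0 vc] : 1 + rho (ys n) * omega != 0 /\ v' (1 + rho (ys n) * omega) = 0.
    by apply: near1 iN _; rewrite addrC addKr.
  have sc0 : sigma (1 + rho (ys n) * omega) != 0 by rewrite fmorph_eq0.
  have sy0 : sigma (ys n) != 0 by rewrite fmorph_eq0.
  split; rewrite /= -/(ys n) /next.
  - by rewrite mulf_neq0.
  - by rewrite (Defs.valM hv') // vy vc.
  set r := rho (ys n) in r_om hr c0 vc sc0 *.
  have uE : u = (1 + r) * (ys n * sigma (ys n)).
    by rewrite /r /rho addrC subrK divfK // mulf_neq0.
  have -> : rho (ys n * (1 + r * omega)) =
      - (r * r * (omega * (1 - omega))) / ((1 + r * omega) * sigma (1 + r * omega)).
    rewrite /rho {1}uE rmorphM /=; move: sc0.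
    rewrite rmorphD rmorphM rmorph1 /= srho somega => sc0.
    rewrite -/r in sc0 *.
    by field; rewrite c0 y0 sc0 sy0.
  apply: (val_geMr hv'); last first.
    apply: (val_unit_inv hv'); first by rewrite mulf_neq0.
    by rewrite (Defs.valM hv') // val_sigma vc.
  apply: (val_geN hv'); apply: (val_geMr hv').
    apply: (@val_ge_le _ _ ((i + n)%N%:Z + (i + n)%N%:Z)); first lia.
    exact: (val_geM hv').
  apply: (val_geMl hv') => //.
  by apply: (val_geB hv') => //; apply: val_ge_1.
pose d n := ys n * (rho (ys n) * omega).
have hd n : val_ge v' (i + n)%N (d n).
  have [y0 vy hr] := step n; apply: (val_geMl hv'); first by right; rewrite vy.
  exact: (val_geMr hv').
have hd' (n : nat) : val_ge v' n (d n) by apply: val_ge_le (hd n); lia.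
have ysE n : ys n = 1 + \sum_(j < n) d j.
  elim: n => [|n IH]; first by rewrite big_ord0 addr0.
  by rewrite big_ord_recr /= addrA -IH /d /ys /= -/(ys n) /next mulrDr mulr1.
have [l hl] := unramified_complete hd'.
have lim (n : nat) : val_ge v' n (1 + l - ys n).
  by rewrite ysE opprD addrACA subrr add0r.
have ys_int n : val_ge v' 0 (ys n) by have [_ vy _] := step n; right; rewrite vy.
exists (1 + l).
  have -> : 1 + l - 1 = (l - \sum_(j < i) d j) + \sum_(j < i) d j by ring.
  apply: (Defs.valD hv') => //; apply: (val_ge_sum hv') => j _.
  by apply: val_ge_le (hd j); lia.
apply/eqP; rewrite -subr_eq0; apply/eqP; apply: (val_ge_all0 (v := v')) => n.
have [y0 vy hr] := step n.
have sy0 : sigma (ys n) != 0 by rewrite fmorph_eq0.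
have l_int : val_ge v' 0 (1 + l).
  by rewrite -(subrK (ys n) (1 + l)); apply: (Defs.valD hv') => //; apply: val_ge_le (lim n).
have -> : (1 + l) * sigma (1 + l) - u =
    (1 + l - ys n) * sigma (1 + l) + ys n * sigma (1 + l - ys n)
    - (ys n * sigma (ys n)) * rho (ys n).
  rewrite /rho rmorphB /=; by field; rewrite y0 sy0.
apply: (val_geB hv').
  apply: (Defs.valD hv').
    by apply: (val_geMr hv') => //; apply: val_ge_sigma.
  by apply: (val_geMl hv') => //; apply: val_ge_sigma.
apply: (val_geMl hv').
  by apply: (val_geMl hv') => //; apply: val_ge_sigma.
by apply: val_ge_le hr; lia.
Qed.

(** [u] is a norm modulo the maximal ideal by counting; the quotient of [u] by that norm is
    congruent to 1 and is lifted by [norm_lift]. *)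
Let norm_unit u : u != 0 -> v' u = 0 -> sigma u = u ->
  exists z, [/\ z != 0, v' z = 0 & z * sigma z = u].
Proof.
move=> u0 vu su.
have [a ha ua] := fixed_by_sigma su (val_ge_val v' u); rewrite vu in ha.
have [x [y [hx hy hxy]]] := binary_form_mod hv res_fin heps.2 heps.1 ha.
pose z := x%:A + y%:A * theta.
have Nz : z * sigma z = (x ^+ 2 - eps * y ^+ 2)%:A.
  rewrite /z rmorphD rmorphM /= !rmorph_alg stheta.
  have -> : (x%:A + y%:A * theta) * (x%:A + y%:A * - theta) =
     x%:A ^+ 2 - theta ^+ 2 * y%:A ^+ 2 by ring.
  by rewrite hsqrt -!(rmorphXn (in_alg k')) -(rmorphM (in_alg k')) -(rmorphB (in_alg k')).
have z_int : val_ge v' 0 z.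
  apply: (Defs.valD hv'); first exact: val_ge_A.
  by apply: (val_geMr hv'); [exact: val_ge_A|right; rewrite val_theta].
have hz : val_ge v' 1 (z * sigma z - u) by rewrite Nz ua -scalerBl; apply: val_ge_A.
have [Nz0 vNz] : z * sigma z != 0 /\ v' (z * sigma z) = 0.
  by have := valD_lt hv' u0 (y := z * sigma z - u); rewrite vu add0r [u + _]addrC subrK; apply.
have z0 : z != 0 by apply/eqP => z0; move: Nz0; rewrite z0 mul0r eqxx.
have sz0 : sigma z != 0 by rewrite fmorph_eq0.
have vz : v' z = 0 by move: vNz; rewrite (Defs.valM hv') // val_sigma; lia.
have [||y' hy' Ny] := norm_lift (i := 1) (u := u / (z * sigma z)) isT.
- by rewrite fmorph_div rmorphM /= sigmaK su [sigma z * _]mulrC.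
- have -> : u / (z * sigma z) - 1 = - (z * sigma z - u) / (z * sigma z) by field; rewrite z0 sz0.
  apply: (val_geMr hv'); first exact: val_geN.
  exact: val_unit_inv.
exists (z * y').
have e : z * y' * sigma (z * y') = u.
  by rewrite rmorphM /= mulrACA Ny mulrC divfK.
have y0 : y' != 0 by apply/eqP => y0; move: u0; rewrite -e y0 mulr0 mul0r eqxx.
have sy0 : sigma y' != 0 by rewrite fmorph_eq0.
split=> //; first by rewrite mulf_neq0.
have := vu; rewrite -e !(Defs.valM hv') ?mulf_neq0 ?fmorph_eq0 ?mulf_neq0 // val_sigma.
rewrite (Defs.valM hv') //; lia.
Qed.

Lemma unramified_involution_extension :
  unramified_involution sigma v' pi%:A theta.
Proof.
have [pi0 vpi] := hpi; have [om0 vom] := omega_unit.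
have tE : 1 + theta = 2%:R * omega by rewrite thetaE addrC subrK.
split=> //.
- by rewrite alg_eq0.
- by rewrite (hk'.2 _ pi0) mul1r.
- exact: (rmorph_alg sigma).
- by rewrite tE mulf_neq0.
- by rewrite tE (Defs.valM hv') // vom addr0.
- by move=> n; have := k_char0 n; rewrite -(fmorph_eq0 (in_alg k')) /= scaler_nat.
- by exists omega => //=; rewrite somega addrC subrK.
Qed.

End Unramified.

(** * Hermitian lattices with an involution *)

(** The trace of an idempotent is its rank: in the full-rank factorization of [Q], the product in
    the other order is an identity matrix. *)
Lemma idempotent_trace0 (F : fieldType) m (Q : 'M[F]_m) :
  (forall n, n.+1%:R != 0 :> F) -> Q *m Q = Q -> \tr Q = 0 -> Q = 0.
Proof.
move=> ch0 QQ; rewrite -[in \tr Q](mulmx_base Q) mxtrace_mulC.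
have -> : row_base Q *m col_base Q = 1%:M.
  apply: (row_full_inj (col_base_full Q)); apply: (row_free_inj (row_base_free Q)).
  by rewrite /= mulmx1 mulmxA mulmx_base -mulmxA mulmx_base QQ.
rewrite mxtrace1; have [/eqP|r] := posnP (\rank Q); first by rewrite mxrank_eq0 => /eqP.
by case: (\rank Q) r (ch0 (\rank Q).-1) => // r _ /eqP.
Qed.

Section IntegralMatrices.

Variables (F : fieldType) (v : F -> int).
Hypothesis hv : normalized_valuation v.

Definition mx_ge m n (N : int) (A : 'M[F]_(m, n)) : Prop :=
  forall i j, val_ge v N (A i j).

Lemma mx_geD m n N (A B : 'M_(m, n)) : mx_ge N A -> mx_ge N B -> mx_ge N (A + B).
Proof. by move=> hA hB i j; rewrite mxE; apply: (Defs.valD hv). Qed.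

Lemma mx_geB m n N (A B : 'M_(m, n)) : mx_ge N A -> mx_ge N B -> mx_ge N (A - B).
Proof. by move=> hA hB i j; rewrite !mxE; apply: val_geB. Qed.

Lemma mx_geM m n q N M (A : 'M_(m, n)) (B : 'M_(n, q)) :
  mx_ge N A -> mx_ge M B -> mx_ge (N + M) (A *m B).
Proof.
by move=> hA hB i j; rewrite mxE; apply: val_ge_sum => // l _; apply: val_geM.
Qed.

Lemma mx_geZ m n N M a (A : 'M_(m, n)) :
  val_ge v N a -> mx_ge M A -> mx_ge (N + M) (a *: A).
Proof. by move=> ha hA i j; rewrite mxE; apply: val_geM. Qed.

Lemma mx_ge1 m : mx_ge 0 (1%:M : 'M_m).
Proof. by move=> i j; rewrite mxE; apply: val_ge_nat. Qed.

End IntegralMatrices.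

Section ConjugateTranspose.

Variables (F : fieldType) (sigma : {rmorphism F -> F}).
Hypothesis sigmaK : forall x, sigma (sigma x) = x.

Definition ctr m n (A : 'M[F]_(m, n)) : 'M[F]_(n, m) := map_mx sigma A^T.

Lemma ctrK m n (A : 'M_(m, n)) : ctr (ctr A) = A.
Proof. by apply/matrixP => i j; rewrite !mxE sigmaK. Qed.

Lemma ctrM m n q (A : 'M_(m, n)) (B : 'M_(n, q)) : ctr (A *m B) = ctr B *m ctr A.
Proof. by rewrite /ctr trmx_mul map_mxM. Qed.

Lemma ctrD m n (A B : 'M_(m, n)) : ctr (A + B) = ctr A + ctr B.
Proof. by rewrite /ctr raddfD map_mxD. Qed.

Lemma ctrB m n (A B : 'M_(m, n)) : ctr (A - B) = ctr A - ctr B.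
Proof. by rewrite /ctr raddfB map_mxB. Qed.

Lemma ctrZ m n a (A : 'M_(m, n)) : ctr (a *: A) = sigma a *: ctr A.
Proof. by apply/matrixP => i j; rewrite !mxE rmorphM. Qed.

Lemma ctr0 m n : ctr (0 : 'M_(m, n)) = 0.
Proof. by rewrite /ctr trmx0 map_mx0. Qed.

Lemma ctr1 m : ctr (1%:M : 'M_m) = 1%:M.
Proof. by rewrite /ctr trmx1 map_mx1. Qed.

End ConjugateTranspose.

(** * Hermitian forms attaining their scale, and isotropic vectors adapted to an involution *)

Section Hermitian.

Variables (F : fieldType) (sigma : {rmorphism F -> F}) (v : F -> int) (w theta : F).
Hypothesis U : unramified_involution sigma v w theta.

Let hv := ui_val U.
Let sigmaK := ui_inv U.
Let two0 : (2%:R : F) != 0 := ui_char0 U 1.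

Local Notation "A ^*" := (ctr sigma A) : ring_scope.
Local Notation mxge := (mx_ge v).

Lemma mx_ge_ctr m n N (A : 'M_(m, n)) : mxge N A -> mxge N A^*.
Proof.
move=> hA i j; rewrite !mxE; have [->|h] := hA j i; first by rewrite rmorph0; left.
by right; rewrite (ui_val_sigma U).
Qed.

Lemma val_wz (N : int) : v (w ^ N) = N.
Proof. by rewrite (valXz hv) ?(ui_w0 U) // (ui_vw U) mulr1. Qed.

Lemma wz_neq0 (N : int) : w ^ N != 0.
Proof. by rewrite expfz_neq0 // (ui_w0 U). Qed.

Lemma sigma_wz (N : int) : sigma (w ^ N) = w ^ N.
Proof. by rewrite fmorphXz (ui_sw U). Qed.

(** [l] is the least valuation of an entry. If no diagonal entry attains it, an entry [D i j] does,
    and a combination of the basis vectors [i] and [j] has a value whose cross terms dominate. *)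
Lemma hermitian_represents_scale m (D : 'M[F]_m) : D^* = D -> D != 0 ->
  exists l (y : 'cV_m), [/\ mxge l D, mxge 0 y &
    (y^* *m D *m y) 0 0 != 0 /\ v ((y^* *m D *m y) 0 0) = l].
Proof.
move=> DD D0.
have Dsym i j : sigma (D i j) = D j i by rewrite -[in RHS]DD !mxE.
have [ij0 hij0] : exists ij : 'I_m * 'I_m, D ij.1 ij.2 != 0.
  apply: contrapT => no; move/eqP: D0; apply; apply/matrixP => i j; rewrite mxE.
  by apply: contrapT => /eqP h; apply: no; exists (i, j).
case: (@arg_minP _ _ _ ij0 (fun ij => D ij.1 ij.2 != 0) (fun ij => v (D ij.1 ij.2)) hij0)
  => -[i j] /= Dij Dmin.
pose l := v (D i j).
have Dl : mxge l D.
  move=> a b; have [->|ab0] := eqVneq (D a b) 0; [by left|right].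
  exact: (Dmin (a, b)).
have d_int (a : 'I_m) : mxge 0 (delta_mx a 0 : 'cV_m).
  by move=> b c; rewrite mxE; apply: val_ge_nat.
have dquad a b : ((delta_mx a 0 : 'cV_m)^* *m D *m (delta_mx b 0 : 'cV_m)) 0 0 = D a b.
  have -> : (delta_mx a 0 : 'cV_m)^* = delta_mx 0 a by rewrite /ctr trmx_delta map_delta_mx.
  by rewrite -rowE -colE !mxE.
have [[a [a0 va]]|nodiag] := pselect (exists a, D a a != 0 /\ v (D a a) = l).
  by exists l, (delta_mx a 0); split=> //; rewrite dquad.
have diag a : val_ge v (l + 1) (D a a).
  have [->|a0] := eqVneq (D a a) 0; [by left|right].
  have := Dmin (a, a) a0; rewrite /= -/l => h.
  have : v (D a a) <> l by move=> e; apply: nodiag; exists a.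
  lia.
have [om om_int om_tr] := ui_trace U.
(* This makes the two conjugate cross terms [om * w ^ l] and its conjugate, with sum exactly
   [w ^ l]; the choice [z = 1] could let them cancel to higher valuation. *)
pose z := om * (w ^ l / D i j).
have z_int : val_ge v 0 z.
  apply: (val_geMr hv) => //; right.
  by rewrite (valf_div hv) ?wz_neq0 // val_wz subrr.
have sz_int : val_ge v 0 (sigma z).
  by case: z_int => [->|h]; [left; rewrite rmorph0|right; rewrite (ui_val_sigma U)].
pose y1 : 'cV[F]_m := delta_mx i 0; pose y2 : 'cV[F]_m := delta_mx j 0.
exists l, (y1 + z *: y2); split=> //.
  apply: (mx_geD hv); [exact: d_int|]; rewrite -(addr0 0); apply: (mx_geZ hv) => //; apply: d_int.
have -> : ((y1 + z *: y2)^* *m D *m (y1 + z *: y2)) 0 0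
   = w ^ l + (D i i + sigma z * z * D j j).
  rewrite ctrD ctrZ !mulmxDl !mulmxDr -!scalemxAl -!scalemxAr ![((_ + _ : 'M_1) 0 0)]mxE.
  rewrite ![((_ *: _ : 'M_1) 0 0)]mxE !dquad.
  have zD : z * D i j = om * w ^ l by rewrite /z -mulrA divfK.
  have szD : sigma z * D j i = sigma om * w ^ l by rewrite -Dsym -rmorphM /= zD rmorphM sigma_wz.
  have -> : w ^ l = z * D i j + sigma z * D j i by rewrite zD szD -mulrDl om_tr mul1r.
  ring.
have := valD_lt hv (wz_neq0 l); rewrite val_wz; apply.
apply: (Defs.valD hv); first exact: diag.
by apply: (val_geMl hv) => //; apply: (val_geMl hv).
Qed.

Variables (m : nat) (J : 'M[F]_m).
Hypotheses (JJ : J *m J = 1%:M) (Jherm : J^* = J) (J_int : mxge 0 J).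

Definition hform (x y : 'cV[F]_m) : F := (x^* *m J *m y) 0 0.

Lemma hformDr x y z : hform x (y + z) = hform x y + hform x z.
Proof. by rewrite /hform mulmxDr mxE. Qed.

Lemma hformDl x y z : hform (x + y) z = hform x z + hform y z.
Proof. by rewrite /hform ctrD !mulmxDl mxE. Qed.

Lemma hformZr a x y : hform x (a *: y) = a * hform x y.
Proof. by rewrite /hform -scalemxAr mxE. Qed.

Lemma hformZl a x y : hform (a *: x) y = sigma a * hform x y.
Proof. by rewrite /hform ctrZ -!scalemxAl mxE. Qed.

Lemma hformNr x y : hform x (- y) = - hform x y.
Proof. by rewrite -scaleN1r hformZr mulN1r. Qed.

Lemma hformBr x y z : hform x (y - z) = hform x y - hform x z.
Proof. by rewrite hformDr hformNr. Qed.

Lemma hformC x y : hform y x = sigma (hform x y).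
Proof.
rewrite /hform; have -> : y^* *m J *m x = (x^* *m J *m y)^*.
  by rewrite !ctrM ctrK // Jherm mulmxA.
by rewrite !mxE.
Qed.

Lemma hform_adj (A : 'M_m) x y : A^* *m J = J *m A ->
  hform (A *m x) y = hform x (A *m y).
Proof. by move=> AJ; rewrite /hform ctrM -!mulmxA [A^* *m (J *m y)]mulmxA AJ !mulmxA. Qed.

Lemma hform_ge N M x y : mxge N x -> mxge M y -> val_ge v (N + M) (hform x y).
Proof.
move=> hx hy; have := mx_geM hv (mx_geM hv (mx_ge_ctr hx) J_int) hy.
by rewrite addr0 => /(_ 0 0).
Qed.

Lemma outer_hform (x y z : 'cV_m) : x *m y^* *m J *m z = hform y z *: x.
Proof.
rewrite -!mulmxA (mulmxA (y^*)) [X in x *m X]mx11_scalar mul_mx_scalar.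
by rewrite /hform.
Qed.

(* [1 - s] kills one eigenspace of [s] and acts as 2 on the other; hence the bound. *)
Lemma involution_scale (s P : 'M_m) :
  s *m s = 1%:M -> s^* *m J = J *m s -> P *m P = P -> P^* *m J = J *m P ->
  s *m P = P *m s -> mxge 0 P -> (1%:M - s) *m P != 0 ->
  exists l (y : 'cV_m), let d := hform y ((1%:M - s) *m y) in
  [/\ mxge l ((1%:M - s) *m P) /\ l <= v 2%:R,
      forall N, mxge N ((1%:M - s) *m P) -> N <= l,
      mxge 0 y /\ P *m y = y,
      d != 0 /\ v d = l & sigma d = d].
Proof.
move=> ss sJ PP PJ sP P_int sP0.
set s1 := 1%:M - s.
have s1J : s1^* *m J = J *m s1 by rewrite ctrB ctr1 mulmxBl mulmxBr mul1mx mulmx1 sJ.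
have s1P : s1 *m P = P *m s1 by rewrite mulmxBl mulmxBr mul1mx mulmx1 sP.
(* This is the Gram matrix of the form sending [x], [y] to [h(x, s1 (P y))]. Its entries have the
   same scale as those of [s1 *m P], because [J] is an integral involution. *)
have [||l [y0 [Dl y0_int [d0 vd]]]] := @hermitian_represents_scale m (J *m s1 *m P).
- by rewrite !ctrM Jherm s1J mulmxA PJ -mulmxA -s1P mulmxA.
- apply: contra_neq sP0 => h; rewrite -/s1 -[LHS]mul1mx -JJ -mulmxA [J *m (s1 *m P)]mulmxA.
  by rewrite h mulmx0.
have s1Pl : mxge l (s1 *m P).
  have -> : s1 *m P = J *m (J *m s1 *m P) by rewrite !mulmxA JJ mul1mx.
  by rewrite -(add0r l); apply: (mx_geM hv).
pose y := P *m y0.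
have y_int : mxge 0 y by rewrite -(addr0 0); apply: (mx_geM hv).
have Py : P *m y = y by rewrite mulmxA PP.
have dE : hform y (s1 *m y) = (y0^* *m (J *m s1 *m P) *m y0) 0 0.
  rewrite /hform /y ctrM; congr (_ 0 0).
  rewrite !mulmxA -(mulmxA (y0^*)) PJ !mulmxA -(mulmxA _ P s1) -s1P !mulmxA.
  by rewrite -(mulmxA _ P P) PP.
have exact N : mxge N (s1 *m P) -> N <= l.
  move=> hN; rewrite -vd; apply: (val_geE d0); rewrite -dE -(add0r N).
  have -> : s1 *m y = (s1 *m P) *m y by rewrite -mulmxA Py.
  apply: hform_ge => //.
  by rewrite -(addr0 N); apply: (mx_geM hv).
exists l, y; rewrite dE; split=> //.
- split=> //.
  have s1s1 : s1 *m s1 = 2%:R *: s1.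
    by rewrite mulmxBl mulmxBr !mulmxBr !mulmx1 !mul1mx ss opprB scaler_nat mulr2n addrA addrAC.
  (* Applying [s1] twice gains [w ^ (l + l)], whereas [s1 *m s1] is twice [s1], so the same value
     has valuation [v 2%:R + l]. *)
  have : val_ge v (l + l) (hform y (s1 *m (s1 *m y))).
    rewrite -(add0r (l + l)); apply: hform_ge => //.
    have -> : s1 *m (s1 *m y) = (s1 *m P) *m ((s1 *m P) *m y).
      by rewrite -!mulmxA Py !mulmxA -(mulmxA _ P s1) -s1P -!mulmxA Py.
    apply: (mx_geM hv) => //; rewrite -(addr0 l); exact: (mx_geM hv).
  rewrite mulmxA s1s1 -scalemxAl hformZr dE => /(val_geE (mulf_neq0 two0 d0)).
  rewrite (Defs.valM hv) // vd; lia.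
- by rewrite -dE -hformC hform_adj.
Qed.

(** For [x = al *: y + be *: W], twice [h(x, x)] is the norm of [al + 2 be] times [d], minus the
    norm of [al] times [d - 2 a], where [a = h(y, y)]. Moreover [h(x, s x)] is [h(x, x)] minus the
    first of these terms. Isotropy and the prescribed value thus become two norm equations. *)
Lemma isotropic_vector (s P : 'M_m) :
  s *m s = 1%:M -> s^* *m J = J *m s -> P *m P = P -> P^* *m J = J *m P ->
  s *m P = P *m s -> mxge 0 P ->
  (1%:M - s) *m P != 0 -> (1%:M + s) *m P != 0 ->
  exists l (x : 'cV_m),
  [/\ mxge l ((1%:M - s) *m P) /\ l <= v 2%:R,
      forall N, mxge N ((1%:M - s) *m P) -> N <= l,
      mxge 0 x /\ P *m x = x,
      hform x x = 0 & hform x (s *m x) = w ^ l].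
Proof.
move=> ss sJ PP PJ sP P_int nz1 nz2.
have [l [y]] := involution_scale ss sJ PP PJ sP P_int nz1.
set W := (1%:M - s) *m y; set d := hform y W => -[[ml le] lmax [y_int Py] [d0 vd] sd].
exists l.
have sy : s *m y = y - W by rewrite /W mulmxBl mul1mx subKr.
have sW : s *m W = - W.
  by rewrite /W mulmxA mulmxBr mulmx1 ss -opprB mulNmx.
have PW : P *m W = W.
  by rewrite /W mulmxA mulmxBr mulmx1 -sP -[X in X - _]mul1mx -mulmxBl -mulmxA Py.
have W_l : mxge l W.
  by rewrite /W -Py mulmxA -(addr0 l); apply: (mx_geM hv).
have yW : hform y W = d by [].
have Wy : hform W y = d by rewrite hformC -/d sd.
have WW : hform W W = 2%:R * d.
  have -> : hform W W = hform y W - hform (s *m y) W.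
    by rewrite sy -[- W]scaleN1r hformDl hformZl rmorphN rmorph1 mulN1r opprD opprK addrA subrr add0r.
  by rewrite hform_adj // sW hformNr opprK -/d mulr2n mulrDl mul1r.
(* [z] is the future coefficient [al + 2 be]; the sign comes from [h(x, s x) = - h(x, x - s x)] for
   isotropic [x]. *)
have [z [z0 vz zz]] : exists z, [/\ z != 0, v z = 0 & z * sigma z = - w ^ l / d].
  apply: (ui_norm U).
  - by rewrite mulf_neq0 ?invr_eq0 // oppr_eq0 wz_neq0.
  - by rewrite (valf_div hv) ?oppr_eq0 ?wz_neq0 // (valN hv) val_wz vd subrr.
  - by rewrite fmorph_div rmorphN sd /= sigma_wz.
have z_int : val_ge v 0 z by right; rewrite vz.
(* The ratio of the two norms is [1 - 2 a / d], a unit congruent to 1 modulo [w] when [l < v 2%:R];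
   at equality this is no longer guaranteed. *)
have [l_lt|l_ge] := ltP l (v 2%:R).
- pose a := hform y y.
  have a_int : val_ge v 0 a by rewrite -(addr0 0); apply: hform_ge.
  have sa : sigma a = a by rewrite -hformC.
  pose i := `|v 2%:R - l|%N.
  have iE : i%:Z = v 2%:R - l by rewrite /i gtz0_abs // subr_gt0.
  have [||| t ht tt] := ui_norm1 U (i := i) (u := 1 - 2%:R * a / d).
  + by rewrite -ltz_nat iE subr_gt0.
  + by rewrite rmorphB rmorph1 fmorph_div rmorphM rmorph_nat /= sa sd.
  + rewrite addrAC subrr add0r iE; apply: (val_geN hv); apply: (val_geM hv).
      by rewrite -(addr0 (v _)); apply: (val_geM hv) => //; right.
    by right; rewrite (valV hv) // vd.
  have [t0 vt] : t != 0 /\ v t = 0.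
    have := valD_lt hv (oner_neq0 _) (y := t - 1).
    rewrite (val1 hv) add0r [1 + _]addrC subrK; apply; apply: val_ge_le ht.
    by rewrite iE; lia.
  have st0 : sigma t != 0 by rewrite fmorph_eq0.
  (* [be] solves [al + 2 be = z]. Since [t - 1] is divisible by [w ^ (v 2%:R - l)], [be] has
     valuation at least [- l], which the divisibility of [W] by [w ^ l] absorbs. *)
  pose al := z / t; pose be := al * ((t - 1) / 2%:R).
  have alN : al * sigma al * (d - 2%:R * a) = - w ^ l.
    rewrite /al fmorph_div.
    have -> : z / t * (sigma z / sigma t) * (d - 2%:R * a) =
      (z * sigma z) * d * (1 - 2%:R * a / d) / (t * sigma t).
      by field; rewrite t0 st0 d0.
    by rewrite tt zz divfK // mulfK // -tt mulf_neq0.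
  have zE : z = al + 2%:R * be by rewrite /be /al; field; rewrite t0 two0.
  have szE : sigma z = sigma al + 2%:R * sigma be by rewrite zE rmorphD rmorphM rmorph_nat.
  have zzd : (al + 2%:R * be) * (sigma al + 2%:R * sigma be) * d = - w ^ l.
    by rewrite -zE -szE zz divfK.
  have al_int : val_ge v 0 al by right; rewrite (valf_div hv) // vz vt.
  have be_ge : val_ge v (- l) be.
    have -> : - l = 0 + (i%:Z + - v 2%:R) by rewrite iE; lia.
    apply: (val_geM hv) => //; apply: (val_geM hv) => //.
    by right; rewrite (valV hv).
  have iso : al * sigma al * a + sigma al * be * d + sigma be * al * d + 2%:R * (sigma be * be * d) = 0.
    apply: (mulfI two0); rewrite mulr0.
    rewrite -[RHS](subrr (- w ^ l)) -{1}zzd -alN; ring.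
  exists (al *: y + be *: W); split=> //.
  + split.
      apply: (mx_geD hv); first by rewrite -(addr0 0); apply: (mx_geZ hv).
      by rewrite -(addNr l); apply: (mx_geZ hv).
    by rewrite mulmxDr -!scalemxAr Py PW.
  + rewrite !(hformDl, hformDr, hformZl, hformZr) yW Wy WW -/a -[RHS]iso; ring.
  + rewrite mulmxDr -!scalemxAr sy sW scalerN !(hformDl, hformBr, hformZl, hformZr) yW Wy WW -/a.
    rewrite -[RHS]addr0 -iso -[w ^ l]opprK -zzd; ring.
have lE : l = v 2%:R by apply/eqP; rewrite eq_le le.
(* Here [(1 - s) P] is divisible by 2, hence so is [(1 + s) P], and the scale bound applied to [- s]
   gives equality there too. *)
have [l1 [y1]] := @involution_scale (- s) P
  ltac:(by rewrite mulmxN mulNmx opprK)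
  ltac:(by rewrite -scaleN1r ctrZ rmorphN rmorph1 !scaleN1r mulNmx mulmxN sJ)
  PP PJ ltac:(by rewrite mulNmx mulmxN sP) P_int ltac:(by rewrite opprK).
rewrite opprK; set W1 := (1%:M + s) *m y1; set d1 := hform y1 W1.
move=> -[[ml1 le1] l1max [y1_int Py1] [d10 vd1] sd1].
have l1E : l1 = v 2%:R.
  apply/eqP; rewrite eq_le le1 /=; apply: l1max.
  have -> : (1%:M + s) *m P = 2%:R *: P - (1%:M - s) *m P.
    by rewrite mulmxDl mulmxBl !mul1mx scaler_nat mulr2n opprB addrA addrAC addrK.
  apply: (mx_geB hv); last by rewrite -lE.
  by rewrite -(addr0 (v _)); apply: (mx_geZ hv) => //; right.
have sy1 : s *m y1 = W1 - y1 by rewrite /W1 mulmxDl mul1mx addrC addKr.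
have sW1 : s *m W1 = W1 by rewrite /W1 mulmxA mulmxDr mulmx1 ss addrC.
have PW1 : P *m W1 = W1.
  by rewrite /W1 mulmxA mulmxDr mulmx1 -sP -[X in X + _]mul1mx -mulmxDl -mulmxA Py1.
have W1_l : mxge l1 W1 by rewrite /W1 -Py1 mulmxA -(addr0 l1); apply: (mx_geM hv).
have W1W1 : hform W1 W1 = 2%:R * d1.
  have -> : hform W1 W1 = hform (s *m y1) W1 + hform y1 W1 by rewrite -hformDl sy1 subrK.
  by rewrite hform_adj // sW1 -/d1 mulr2n mulrDl mul1r.
have WW1 : hform W W1 = 0.
  rewrite /W mulmxBl mul1mx -[- _]scaleN1r hformDl hformZl rmorphN rmorph1 mulN1r.
  by rewrite hform_adj // sW1 subrr.
have W1W : hform W1 W = 0 by rewrite hformC WW1 rmorph0.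
have [z1 [z10 vz1 zz1]] : exists z, [/\ z != 0, v z = 0 & z * sigma z = w ^ l / d1].
  apply: (ui_norm U).
  - by rewrite mulf_neq0 ?invr_eq0 // wz_neq0.
  - by rewrite (valf_div hv) ?wz_neq0 // val_wz vd1 lE l1E subrr.
  - by rewrite fmorph_div sd1 /= sigma_wz.
have half_int : val_ge v (- l) (2%:R^-1) by right; rewrite (valV hv) // lE.
have zzd : z * sigma z * d = - w ^ l by rewrite zz divfK.
have zzd1 : z1 * sigma z1 * d1 = w ^ l by rewrite zz1 divfK.
have s2 : sigma 2%:R^-1 = 2%:R^-1 by rewrite fmorphV rmorph_nat.
(* [W] and [W1] are divisible by 2 and lie in opposite, mutually orthogonal eigenspaces, with
   [h(W, W) = 2 d] and [h(W1, W1) = 2 d1]. The norms of [z] and [z1] make the two halves cancel in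
   [h(x, x)] and add up in [h(x, s x)]. *)
exists (2%:R^-1 *: (z *: W + z1 *: W1)); split=> //.
- split.
    rewrite -(addNr l); apply: (mx_geZ hv) => //; rewrite -(add0r l).
    apply: (mx_geD hv); apply: (mx_geZ hv) => //; first by right; rewrite vz1.
    by rewrite lE -l1E.
  by rewrite -scalemxAr mulmxDr -!scalemxAr PW PW1.
- rewrite !(hformDl, hformDr, hformZl, hformZr) WW WW1 W1W W1W1 s2.
  transitivity (2%:R^-1 * 2%:R^-1 * 2%:R * (z * sigma z * d + z1 * sigma z1 * d1)); first by ring.
  by rewrite zzd zzd1 addNr mulr0.
- rewrite -!scalemxAr mulmxDr -!scalemxAr sW sW1 scalerN.
  rewrite !(hformDl, hformDr, hformZl, hformZr, hformNr) WW WW1 W1W W1W1 s2.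
  transitivity (2%:R^-1 * 2%:R^-1 * 2%:R * (z1 * sigma z1 * d1 - z * sigma z * d)); first by ring.
  by rewrite zzd zzd1; field.
Qed.

End Hermitian.

(** * Decomposition of the lattice into orthogonal stable planes *)

Section AdaptedFrames.

Variables (F : fieldType) (sigma : {rmorphism F -> F}) (v : F -> int) (w theta : F).
Hypothesis U : unramified_involution sigma v w theta.
Variables (m : nat) (J s : 'M[F]_m).
Hypotheses (JJ : J *m J = 1%:M) (Jherm : ctr sigma J = J) (J_int : mx_ge v 0 J).
Hypotheses (ss : s *m s = 1%:M) (sJ : ctr sigma s *m J = J *m s).

Let hv := ui_val U.
Let sigmaK := ui_inv U.
Let two0 : (2%:R : F) != 0 := ui_char0 U 1.

Local Notation "A ^*" := (ctr sigma A) : ring_scope.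
Local Notation mxge := (mx_ge v).
Local Notation h := (hform sigma J).

(* Vectors E_a spanning isotropic lines of mutually orthogonal s-stable planes
   inside the image of P, and a unit vector u fixed by s when b holds. *)
Record adapted (P : 'M_m) (r : nat) (b : bool) (N : int) (lam : nat -> int)
    (E : nat -> 'cV[F]_m) (u : 'cV[F]_m) : Prop := {
  ad_proj : forall a, (a < r)%N -> P *m E a = E a;
  ad_int : forall a, (a < r)%N -> mxge 0 (E a);
  ad_diff : forall a, (a < r)%N -> mxge (- lam a) (E a - s *m E a);
  ad_lower : forall a, (a < r)%N -> - v 2%:R <= lam a;
  ad_upper : forall a, (a < r)%N -> lam a <= - N;
  ad_mono : forall a c, (a <= c)%N -> (c < r)%N -> lam c <= lam a;
  ad_iso : forall a c, (a < r)%N -> (c < r)%N -> h (E a) (E c) = 0;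
  ad_gram : forall a c, (a < r)%N -> (c < r)%N ->
    h (E a) (s *m E c) = if a == c then w ^ (- lam a) else 0;
  ad_mid : b -> [/\ mxge 0 u, P *m u = u, s *m u = u, h u u = 1 &
    forall a, (a < r)%N -> h u (E a) = 0] }.

(** The line left over in odd dimension. Equality of the two traces forces [s] to act as 1 on it,
    and unimodularity gives a vector of unit length, which is normalized by a norm. *)
Lemma fixed_unit_vector (P : 'M_m) :
  P *m P = P -> P^* *m J = J *m P -> s *m P = P *m s -> mxge 0 P ->
  \tr P = 1 -> \tr (s *m P) = 1 ->
  exists u : 'cV_m, [/\ mxge 0 u, P *m u = u, s *m u = u & h u u = 1].
Proof.
move=> PP PJ sP P_int trP trsP.
have sPP : s *m P = P.
  apply/eqP; rewrite eq_sym -subr_eq0; apply/eqP.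
  (* The projection onto the (-1)-eigenspace inside the image of [P]; its trace is 0. *)
  pose Q := 2%:R^-1 *: (P - s *m P).
  suff Q0 : Q = 0 by rewrite -[LHS](scalerKV two0) -/Q Q0 scaler0.
  apply: idempotent_trace0 (ui_char0 U) _ _; last first.
    by rewrite /Q mxtraceZ raddfB /= trP trsP subrr mulr0.
  have PsP : P *m (s *m P) = s *m P by rewrite mulmxA -sP -mulmxA PP.
  have RR : (P - s *m P) *m (P - s *m P) = 2%:R *: (P - s *m P).
    rewrite mulmxBl !mulmxBr PP PsP -!mulmxA PP PsP (mulmxA s s) ss mul1mx opprB.
    by rewrite scaler_nat mulr2n.
  by rewrite /Q -scalemxAl -scalemxAr RR !scalerA -mulrA mulVf // mulr1.
have P0 : P != 0.
  apply/eqP => P0; move: trP; rewrite P0 mxtrace0 => /esym/eqP.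
  by rewrite oner_eq0.
have twoP : 1%:M - - 1%:M = 2%:R *: (1%:M : 'M[F]_m) by rewrite opprK scaler_nat mulr2n.
(* For the involution [- 1] the operator [1 - s] is 2, so the scale is exactly [v 2%:R] and
   [h(y, y)] is a unit. *)
have [||||l [y]] := @involution_scale _ _ _ _ _ U _ _ JJ Jherm J_int (- 1%:M) P _ _ PP PJ _ P_int.
- by rewrite mulmxN mulNmx opprK mul1mx.
- by rewrite -scaleN1r ctrZ ctr1 rmorphN rmorph1 scaleN1r mulNmx mulmxN mul1mx mulmx1.
- by rewrite mulNmx mulmxN mul1mx mulmx1.
- by rewrite twoP -scalemxAl mul1mx scaler_eq0 (negPf two0).
rewrite twoP -!scalemxAl !mul1mx hformZr => -[[_ le] lmax [y_int Py] [d0 vd] sd].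
have lE : l = v 2%:R.
  apply/eqP; rewrite eq_le le; apply: lmax.
  by rewrite -(addr0 (v _)); apply: (mx_geZ hv) => //; right.
have c0 : h y y != 0 by move: d0; rewrite mulf_eq0 negb_or => /andP[].
have vc : v (h y y) = 0 by move: vd; rewrite (Defs.valM hv) // lE; lia.
have [z [z0 vz zz]] : exists z, [/\ z != 0, v z = 0 & z * sigma z = (h y y)^-1].
  apply: (ui_norm U).
  - by rewrite invr_eq0.
  - by rewrite (valV hv) // vc.
  - by rewrite fmorphV -(hformC U Jherm).
exists (z *: y); split.
- by rewrite -(addr0 0); apply: (mx_geZ hv) => //; right; rewrite vz.
- by rewrite -scalemxAr Py.
- by rewrite -scalemxAr -{1}Py mulmxA sPP Py.
- by rewrite hformZl hformZr mulrA [sigma z * z]mulrC zz mulVf.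
Qed.

(** Induction on the number of planes, with the current summand of the lattice encoded by its
    orthogonal projection [P]. [\tr P] is its dimension and [\tr (s *m P)] the difference of the
    dimensions of the two eigenspaces; positivity of [r] makes both eigenspaces nonzero. *)
Lemma adapted_exists (r : nat) (b : bool) (P : 'M_m) (N : int) :
  P *m P = P -> P^* *m J = J *m P -> s *m P = P *m s -> mxge 0 P ->
  mxge N ((1%:M - s) *m P) ->
  \tr P = (r.*2 + b)%:R -> \tr (s *m P) = b%:R ->
  exists lam E u, adapted P r b N lam E u.
Proof.
elim: r P N => [|r IH] P N PP PJ sP P_int PN trP trsP.
  exists (fun=> 0), (fun=> 0).
  suff [u hu] : exists u : 'cV_m, b -> [/\ mxge 0 u, P *m u = u, s *m u = u & h u u = 1].
    by exists u; split=> // /hu[].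
  case: b trP trsP => [trP trsP|_ _]; last by exists 0.
  by have [u hu] := fixed_unit_vector PP PJ sP P_int trP trsP; exists u.
have nz (n : nat) : (0 < n)%N -> n%:R != 0 :> F by case: n => // n _; apply: ui_char0 U n.
have [||l [x [[ml le] lmax [x_int Px] xx xsx]]] :=
    @isotropic_vector _ _ _ _ _ U _ _ JJ Jherm J_int s P ss sJ PP PJ sP P_int.
- apply/eqP => /(congr1 mxtrace); rewrite mxtrace0 mulmxBl mul1mx raddfB /= trP trsP.
  by rewrite natrD addrK => /eqP; apply/negP; apply: nz.
- apply/eqP => /(congr1 mxtrace); rewrite mxtrace0 mulmxDl mul1mx raddfD /= trP trsP.
  by rewrite -natrD => /eqP; apply/negP; apply: nz.
pose sx := s *m x.
have sxx : h sx x = w ^ l by rewrite hform_adj.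
have sxsx : h sx sx = 0 by rewrite hform_adj // mulmxA ss mul1mx.
have ssx : s *m sx = x by rewrite mulmxA ss mul1mx.
have Psx : P *m sx = sx by rewrite mulmxA -sP -mulmxA Px.
have wl : w ^ (- l) * w ^ l = 1 by rewrite -expfzDr ?addNr // (ui_w0 U).
(* The orthogonal projection onto the plane of [x] and [s x]: on this basis the Gram matrix is
   [w ^ l] times the swap, whence the crossed terms and the factor [w ^ (- l)]. *)
pose Q := w ^ (- l) *: ((x *m sx^* + sx *m x^*) *m J).
have QE y : Q *m y = w ^ (- l) *: (h sx y *: x + h x y *: sx).
  by rewrite /Q -scalemxAl !mulmxDl !outer_hform.
have Qx : Q *m x = x by rewrite QE sxx xx scale0r addr0 scalerA wl scale1r.
have Qsx : Q *m sx = sx by rewrite QE sxsx xsx scale0r add0r scalerA wl scale1r.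
have AQ (A : 'M_m) : A *m Q = w ^ (- l) *: ((A *m x *m sx^* + A *m sx *m x^*) *m J).
  by rewrite /Q -scalemxAr mulmxA mulmxDr !mulmxA.
have QJ : Q^* *m J = J *m Q.
  rewrite /Q ctrZ (sigma_wz U) -scalemxAl -scalemxAr; congr (_ *: _).
  by rewrite ctrM ctrD !ctrM !ctrK // Jherm addrC !mulmxA.
have QQ : Q *m Q = Q by rewrite AQ Qx Qsx.
have PQ : P *m Q = Q by rewrite AQ Px Psx.
have QP : Q *m P = Q.
  have : J *m (Q *m P) = J *m Q.
    rewrite mulmxA -QJ -mulmxA -PJ mulmxA -ctrM.
    by rewrite PQ.
  by move=> /(congr1 (mulmx J)); rewrite !mulmxA JJ !mul1mx.
have sQ : s *m Q = Q *m s.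
  have : J *m (Q *m s) = J *m (s *m Q).
    rewrite (mulmxA J Q s) -QJ -(mulmxA _ J s) -sJ mulmxA -ctrM AQ ssx -/sx.
    rewrite ctrZ (sigma_wz U) -scalemxAl -scalemxAr; congr (_ *: _).
    by rewrite ctrM ctrD !ctrM !ctrK // Jherm !mulmxA.
  by move=> /(congr1 (mulmx J)); rewrite !mulmxA JJ !mul1mx.
(* The factor [w ^ (- l)] is absorbed by writing [s x] as [x - W]: each resulting term contains [W],
   divisible by [w ^ l], or the factor 2, of valuation at least [l]. *)
have Q_int : mxge 0 Q.
  pose W := x - sx.
  have W_l : mxge l W.
    have -> : W = ((1%:M - s) *m P) *m x by rewrite -mulmxA Px mulmxBl mul1mx.
    by rewrite -(addr0 l); apply: (mx_geM hv).
  have -> : Q = w ^ (- l) *: ((2%:R *: (x *m x^*) - x *m W^* - W *m x^*) *m J).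
    rewrite /Q; congr (_ *: (_ *m _)); rewrite /W ctrB mulmxBl mulmxBr.
    move: (x *m x^*) (x *m sx^*) (sx *m x^*) => A B C.
    by apply/matrixP => i j; rewrite !mxE; ring.
  rewrite -(addNr l); apply: (mx_geZ hv); first by right; rewrite (val_wz U).
  rewrite -(addr0 l); apply: (mx_geM hv) => //.
  have xs := mx_ge_ctr U x_int.
  apply: (mx_geB hv); [apply: (mx_geB hv)|].
  - rewrite -(addr0 l); apply: (mx_geZ hv); first by right.
    by rewrite -(addr0 0); apply: (mx_geM hv).
  - by rewrite -(add0r l); apply: (mx_geM hv) => //; apply: (mx_ge_ctr U).
  - by rewrite -(addr0 l); apply: (mx_geM hv).
have tr_outer (y z : 'cV_m) : \tr (y *m z^* *m J) = h z y.
  by rewrite -mulmxA mxtrace_mulC /mxtrace big_ord1.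
have trQ : \tr Q = 2%:R.
  by rewrite /Q mxtraceZ mulmxDl raddfD /= !tr_outer sxx xsx -mulr2n mulrnAr wl.
have trsQ : \tr (s *m Q) = 0.
  by rewrite AQ ssx -/sx mxtraceZ mulmxDl raddfD /= !tr_outer sxsx xx addr0 mulr0.
pose P' := P - Q.
have PP'E : P *m P' = P' by rewrite mulmxBr PP PQ.
have P'P : P' *m P' = P' by rewrite mulmxBl PP'E mulmxBr QP QQ subrr subr0.
have P'J : P'^* *m J = J *m P' by rewrite ctrB mulmxBl mulmxBr PJ QJ.
have sP' : s *m P' = P' *m s by rewrite mulmxBr mulmxBl sP sQ.
have P'_int : mxge 0 P' by apply: (mx_geB hv).
have P'l : mxge l ((1%:M - s) *m P').
  by rewrite -PP'E mulmxA -(addr0 l); apply: (mx_geM hv).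
have trP' : \tr P' = (r.*2 + b)%:R.
  by rewrite raddfB /= trP trQ doubleS !addSn -addn2 natrD addrK.
have trsP' : \tr (s *m P') = b%:R by rewrite mulmxBr raddfB /= trsP trsQ subr0.
(* Passing the scale [l] just split off as the new lower bound makes all later exponents at most
   [- l], which yields monotonicity. *)
have [lam [E [u ad]]] := IH P' l P'P P'J sP' P'_int P'l trP' trsP'.
have P'x : P' *m x = 0 by rewrite mulmxBl Px Qx subrr.
have x_orth y : P' *m y = y -> h x y = 0.
  by move=> <-; rewrite -hform_adj // P'x -(scale0r 0) hformZl rmorph0 mul0r.
have orth_x y : P' *m y = y -> h y x = 0.
  by move=> hy; rewrite (hformC U Jherm) x_orth ?rmorph0.
have sP'y y : P' *m y = y -> P' *m (s *m y) = s *m y.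
  by move=> hy; rewrite mulmxA -sP' -mulmxA hy.
have PP'y y : P' *m y = y -> P *m y = y by move=> <-; rewrite mulmxA PP'E.
have N_le : N <= l by apply: lmax.
exists (fun a => if a is a'.+1 then lam a' else - l).
exists (fun a => if a is a'.+1 then E a' else x), u; split.
- by move=> [|a] //= ar; apply/PP'y/(ad_proj ad).
- by move=> [|a] //= ar; apply: (ad_int ad).
- move=> [|a] //= ar; last exact: (ad_diff ad).
  have -> : x - s *m x = ((1%:M - s) *m P) *m x by rewrite -mulmxA Px mulmxBl mul1mx.
  by rewrite opprK -(addr0 l); apply: (mx_geM hv).
- by move=> [|a] //= ar; [rewrite lerN2|apply: (ad_lower ad)].
- move=> [|a] //= ar; first by rewrite lerN2.
  by apply: le_trans (ad_upper ad ar) _; rewrite lerN2.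
- move=> [|a] [|c] //= ac cr; first exact: (ad_upper ad).
  exact: (ad_mono ad).
- move=> [|a] [|c] //= ar cr; [exact/x_orth/(ad_proj ad)|exact/orth_x/(ad_proj ad)|].
  exact: (ad_iso ad).
- move=> [|a] [|c] //= ar cr.
  + by rewrite opprK.
  + exact/x_orth/sP'y/(ad_proj ad).
  + by rewrite -hform_adj //; apply/orth_x/sP'y/(ad_proj ad).
  + by rewrite (ad_gram ad).
- move=> /(ad_mid ad)[u_int Pu su uu uE]; split=> //; first exact: PP'y.
  by move=> [|a] //= ar; [apply: orth_x|apply: uE].
Qed.

End AdaptedFrames.

(** * Block matrices and the representatives *)

Section Blocks.

Variables (k : fieldType) (k' : fieldExtType k) (sigma : {lrmorphism k' -> k'}).
Variable m : nat.

Local Notation n := (m./2).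
Local Notation "A ^*" := (ctr sigma A) : ring_scope.

(** Its columns are standard basis vectors. Multiplying by the selectors of [lo] and [hi] extracts
    blocks without casting between index types such as [m] and [n + n]. *)
Definition selector (f : 'I_n -> 'I_m) : 'M[k']_(m, n) := \matrix_(i, a) (i == f a)%:R.
(** It is zero for even [m], so both parities share the same block formulas. *)
Definition mid_col : 'cV[k']_m := \col_i (odd m && (val i == n))%:R.
Definition fdiag (f : 'I_n -> k') : 'M[k']_n := diag_mx (\row_a f a).

Local Notation A := (selector (@lo m)).
Local Notation B := (selector (@hi m)).
Local Notation c := mid_col.
Local Notation D := fdiag.
Local Notation J := (antidiag k' m).

Lemma lo_val a : val (@lo m a) = a :> nat. Proof. by []. Qed.

Lemma hi_val a : val (@hi m a) = (m - a.+1)%N :> nat. Proof. by []. Qed.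

Lemma half_bounds : (n + n <= m <= (n + n).+1)%N.
Proof. by have := odd_double_half m; case: (odd m); rewrite -addnn; lia. Qed.

Lemma lo_inj : injective (@lo m).
Proof. by move=> a b /(congr1 val) h; apply: val_inj. Qed.

Lemma hi_inj : injective (@hi m).
Proof. by move=> a b /rev_ord_inj/lo_inj. Qed.

Lemma lo_neq_hi a b : (lo a == hi b :> 'I_m) = false.
Proof.
apply/negP => /eqP /(congr1 val); rewrite hi_val lo_val.
by have := ltn_ord a; have := ltn_ord b; have := half_bounds; lia.
Qed.

Lemma lo_not_mid a : odd m && (val (@lo m a) == n) = false.
Proof. by rewrite lo_val; have := ltn_ord a; case: (odd m) => //=; lia. Qed.

Lemma hi_not_mid a : odd m && (val (@hi m a) == n) = false.
Proof.
rewrite hi_val; have := ltn_ord a; have := odd_double_half m; rewrite -addnn.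
by case: (odd m) => //=; lia.
Qed.

Variant ord_spec (i : 'I_m) : Prop :=
| OrdLo a of i = lo a
| OrdHi a of i = hi a
| OrdMid of odd m && (val i == n).

Lemma ordP i : ord_spec i.
Proof.
have [h|h] := ltnP i n; first by apply: (OrdLo (a := Ordinal h)); apply: val_inj.
have hi := ltn_ord i; have := odd_double_half m; rewrite -addnn.
have [e|ne] := eqVneq (odd m && (val i == n)) true; first by move=> _; apply: OrdMid.
move=> dh; have h' : (m - i.+1 < n)%N.
  by move: ne dh; case: (odd m) => //= ne dh; lia.
by apply: (OrdHi (a := Ordinal h')); apply: val_inj => /=; lia.
Qed.

Lemma selector_tr_mul f g : (selector f)^T *m selector g = \matrix_(a, b) (f a == g b)%:R.
Proof.
apply/matrixP => a b; rewrite !mxE (bigD1 (f a)) //= !mxE eqxx mul1r big1 ?addr0 // => i ne.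
by rewrite !mxE (negPf ne) mul0r.
Qed.

Lemma lo_tr_lo : A^T *m A = 1%:M.
Proof. by rewrite selector_tr_mul; apply/matrixP => a b; rewrite !mxE (inj_eq lo_inj). Qed.

Lemma hi_tr_hi : B^T *m B = 1%:M.
Proof. by rewrite selector_tr_mul; apply/matrixP => a b; rewrite !mxE (inj_eq hi_inj). Qed.

Lemma lo_tr_hi : A^T *m B = 0.
Proof. by rewrite selector_tr_mul; apply/matrixP => a b; rewrite !mxE lo_neq_hi. Qed.

Lemma hi_tr_lo : B^T *m A = 0.
Proof. by rewrite selector_tr_mul; apply/matrixP => a b; rewrite !mxE eq_sym lo_neq_hi. Qed.

Lemma selector_tr_mid f : (forall a, odd m && (val (f a) == n) = false) ->
  (selector f)^T *m c = 0.
Proof.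
move=> h; apply/matrixP => a j; rewrite !mxE big1 // => i _; rewrite !mxE.
by have [->|] := eqVneq i (f a); rewrite ?h ?mulr0 ?mul0r.
Qed.

Lemma lo_tr_mid : A^T *m c = 0. Proof. exact/selector_tr_mid/lo_not_mid. Qed.
Lemma hi_tr_mid : B^T *m c = 0. Proof. exact/selector_tr_mid/hi_not_mid. Qed.

Lemma mid_tr_lo : c^T *m A = 0.
Proof. by apply: trmx_inj; rewrite trmx_mul trmxK lo_tr_mid trmx0. Qed.

Lemma mid_tr_hi : c^T *m B = 0.
Proof. by apply: trmx_inj; rewrite trmx_mul trmxK hi_tr_mid trmx0. Qed.

Lemma mid_tr_mid : c^T *m c = (odd m)%:R%:M.
Proof.
apply/matrixP => i j; rewrite !ord1 !mxE eqxx mulr1n.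
have [o|] := boolP (odd m); last first.
  by move=> /negPf o; rewrite big1 // => l _; rewrite !mxE o mul0r.
have nm : (n < m)%N by have := odd_double_half m; rewrite o -addnn; lia.
rewrite (bigD1 (Ordinal nm)) //= !mxE o eqxx mulr1 big1 ?addr0 // => l ne.
rewrite !mxE o /=; have [e|] := eqVneq (val l) n; last by rewrite mul0r.
by case/eqP: ne; apply: val_inj.
Qed.

Lemma mid_col_even : ~~ odd m -> c = 0.
Proof. by move=> /negPf o; apply/matrixP => i j; rewrite !mxE o. Qed.

Lemma mid_mid_tr_mid : c *m (c^T *m c) = c.
Proof.
have [o|o] := boolP (odd m); first by rewrite mid_tr_mid o mulmx1.
by rewrite mid_col_even // mul0mx.
Qed.

Lemma lo_hi_mid_resolution : A *m A^T + B *m B^T + c *m c^T = 1%:M.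
Proof.
apply/matrixP => i j; rewrite !mxE big_ord1 !mxE.
case: (ordP i) => [a ->|a ->|i_mid].
- rewrite lo_not_mid mul0r addr0 (bigD1 a) //= !mxE eqxx mul1r big1; last first.
    by move=> b ne; rewrite !mxE (inj_eq lo_inj) eq_sym (negPf ne) mul0r.
  by rewrite big1 ?addr0 1?eq_sym // => b _; rewrite !mxE lo_neq_hi mul0r.
- rewrite hi_not_mid mul0r addr0 big1 ?add0r; last first.
    by move=> b _; rewrite !mxE eq_sym lo_neq_hi mul0r.
  rewrite (bigD1 a) //= !mxE eqxx mul1r big1 ?addr0 1?eq_sym // => b ne.
  by rewrite !mxE (inj_eq hi_inj) eq_sym (negPf ne) mul0r.
- rewrite i_mid mul1r !big1 ?add0r.
  + suff -> : (i == j) = odd m && (val j == n) by [].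
    apply/eqP/idP => [<- //|/andP[_ /eqP e]]; apply: val_inj.
    by rewrite e; case/andP: i_mid => _ /eqP.
  + move=> b _; rewrite !mxE; have [e|] := eqVneq i (hi b); last by rewrite mul0r.
    by move: i_mid; rewrite e hi_not_mid.
  + move=> b _; rewrite !mxE; have [e|] := eqVneq i (lo b); last by rewrite mul0r.
    by move: i_mid; rewrite e lo_not_mid.
Qed.

Lemma antidiagM q (X : 'M[k']_(m, q)) i j : (J *m X) i j = X (rev_ord i) j.
Proof.
rewrite mxE (bigD1 (rev_ord i)) //= !mxE eqxx mul1r big1 ?addr0 // => l ne.
by rewrite !mxE (negPf ne) mul0r.
Qed.

Lemma antidiagK : J *m J = 1%:M.
Proof. by apply/matrixP => i j; rewrite antidiagM !mxE rev_ordK eq_sym. Qed.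

Lemma antidiag_lo : J *m A = B.
Proof.
by apply/matrixP => i j; rewrite antidiagM !mxE /hi (can2_eq rev_ordK rev_ordK).
Qed.

Lemma antidiag_hi : J *m B = A.
Proof. by rewrite -antidiag_lo mulmxA antidiagK mul1mx. Qed.

Lemma antidiag_mid : J *m c = c.
Proof.
apply/matrixP => i j; rewrite antidiagM !mxE /=.
have := odd_double_half m; have := ltn_ord i; case: (odd m) => //=; rewrite -addnn => hi dh.
by congr (_%:R); apply: congr1; apply/eqP/eqP; lia.
Qed.

Lemma antidiag_tr : J^T = J.
Proof. by apply/matrixP => i j; rewrite !mxE eq_sym (can2_eq rev_ordK rev_ordK). Qed.

Lemma fdiagM f g : D f *m D g = D (fun a => f a * g a).
Proof. by rewrite /fdiag mulmx_diag; congr diag_mx; apply/rowP => a; rewrite !mxE. Qed.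

Lemma fdiagD f g : D f + D g = D (fun a => f a + g a).
Proof.
by apply/matrixP => a b; rewrite !mxE; case: eqP => _; rewrite ?mulr1n // !mulr0n addr0.
Qed.

Lemma eq_fdiag f g : f =1 g -> D f = D g.
Proof. by move=> fg; congr diag_mx; apply/rowP => a; rewrite !mxE. Qed.

Lemma fdiag1 : D (fun=> 1) = 1%:M.
Proof. by apply/matrixP => a b; rewrite !mxE. Qed.

Lemma fdiag0 : D (fun=> 0) = 0.
Proof. by apply/matrixP => a b; rewrite !mxE mul0rn. Qed.

Lemma ctr_fdiag f : (D f)^* = D (sigma \o f).
Proof. by apply/matrixP => a b; rewrite !mxE eq_sym rmorphMn /=; case: eqP => [->|]. Qed.

(* The s-stable planes spanned by the basis vectors [lo a] and [hi a] carry the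
   2x2 matrices [[f1 a, f2 a], [f3 a, f4 a]]; the middle vector is fixed. *)
Definition blk (f1 f2 f3 f4 : 'I_n -> k') : 'M[k']_m :=
  A *m D f1 *m A^T + A *m D f2 *m B^T + B *m D f3 *m A^T + B *m D f4 *m B^T + c *m c^T.

Lemma eq_blk f1 f2 f3 f4 g1 g2 g3 g4 :
  f1 =1 g1 -> f2 =1 g2 -> f3 =1 g3 -> f4 =1 g4 -> blk f1 f2 f3 f4 = blk g1 g2 g3 g4.
Proof. by move=> /eq_fdiag e1 /eq_fdiag e2 /eq_fdiag e3 /eq_fdiag e4; rewrite /blk e1 e2 e3 e4. Qed.

Lemma blk_lo f1 f2 f3 f4 : blk f1 f2 f3 f4 *m A = A *m D f1 + B *m D f3.
Proof. by rewrite /blk !mulmxDl -!mulmxA lo_tr_lo hi_tr_lo mid_tr_lo !mulmx0 !mulmx1 !addr0. Qed.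

Lemma blk_hi f1 f2 f3 f4 : blk f1 f2 f3 f4 *m B = A *m D f2 + B *m D f4.
Proof. by rewrite /blk !mulmxDl -!mulmxA lo_tr_hi hi_tr_hi mid_tr_hi !mulmx0 !mulmx1 !addr0 add0r. Qed.

Lemma blk_mid f1 f2 f3 f4 : blk f1 f2 f3 f4 *m c = c.
Proof. by rewrite /blk !mulmxDl -!mulmxA lo_tr_mid hi_tr_mid !mulmx0 !add0r mid_mid_tr_mid. Qed.

Lemma lo_tr_blk f1 f2 f3 f4 : A^T *m blk f1 f2 f3 f4 = D f1 *m A^T + D f2 *m B^T.
Proof. by rewrite /blk !mulmxDr !mulmxA lo_tr_lo lo_tr_hi lo_tr_mid !mul0mx !mul1mx !addr0. Qed.

Lemma hi_tr_blk f1 f2 f3 f4 : B^T *m blk f1 f2 f3 f4 = D f3 *m A^T + D f4 *m B^T.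
Proof. by rewrite /blk !mulmxDr !mulmxA hi_tr_lo hi_tr_hi hi_tr_mid !mul0mx !mul1mx !add0r addr0. Qed.

Lemma mid_tr_blk f1 f2 f3 f4 : c^T *m blk f1 f2 f3 f4 = c^T.
Proof.
rewrite /blk !mulmxDr !mulmxA mid_tr_lo mid_tr_hi !mul0mx !add0r.
by apply: trmx_inj; rewrite !trmx_mul !trmxK mid_mid_tr_mid.
Qed.

Lemma mx_ext_lo_hi_mid (X Y : 'M[k']_m) : X *m A = Y *m A -> X *m B = Y *m B ->
  X *m c = Y *m c -> X = Y.
Proof.
move=> hA hB hc; rewrite -[X]mulmx1 -[Y]mulmx1 -lo_hi_mid_resolution !mulmxDr !mulmxA.
by rewrite hA hB hc.
Qed.

Lemma blkM f1 f2 f3 f4 g1 g2 g3 g4 : blk f1 f2 f3 f4 *m blk g1 g2 g3 g4 =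
  blk (fun a => f1 a * g1 a + f2 a * g3 a) (fun a => f1 a * g2 a + f2 a * g4 a)
      (fun a => f3 a * g1 a + f4 a * g3 a) (fun a => f3 a * g2 a + f4 a * g4 a).
Proof.
apply: mx_ext_lo_hi_mid; rewrite -mulmxA ?blk_mid // ?blk_lo ?blk_hi mulmxDr !mulmxA blk_lo blk_hi.
  by rewrite !mulmxDl -!mulmxA !fdiagM addrACA -!mulmxDr !fdiagD.
by rewrite !mulmxDl -!mulmxA !fdiagM addrACA -!mulmxDr !fdiagD.
Qed.

Lemma blk_id : blk (fun=> 1) (fun=> 0) (fun=> 0) (fun=> 1) = 1%:M.
Proof.
apply: mx_ext_lo_hi_mid; rewrite ?blk_lo ?blk_hi ?blk_mid ?mul1mx // fdiag1 fdiag0.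
  by rewrite mulmx1 mulmx0 addr0.
by rewrite mulmx1 mulmx0 add0r.
Qed.

Lemma antidiag_blk : J = blk (fun=> 0) (fun=> 1) (fun=> 1) (fun=> 0).
Proof.
apply: mx_ext_lo_hi_mid; rewrite ?blk_lo ?blk_hi ?blk_mid ?antidiag_lo ?antidiag_hi ?antidiag_mid // fdiag1 fdiag0.
  by rewrite mulmx1 mulmx0 add0r.
by rewrite mulmx1 mulmx0 addr0.
Qed.

Lemma ctr_selector f : (selector f)^* = (selector f)^T.
Proof. by apply/matrixP => i j; rewrite !mxE rmorph_nat. Qed.

Lemma ctr_selectorT f : ((selector f)^T)^* = selector f.
Proof. by apply/matrixP => i j; rewrite !mxE rmorph_nat. Qed.

Lemma ctr_mid : c^* = c^T.
Proof. by apply/matrixP => i j; rewrite !mxE rmorph_nat. Qed.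

Lemma ctr_midT : (c^T)^* = c.
Proof. by apply/matrixP => i j; rewrite !mxE rmorph_nat. Qed.

Lemma ctr_blk f1 f2 f3 f4 :
  (blk f1 f2 f3 f4)^* = blk (sigma \o f1) (sigma \o f3) (sigma \o f2) (sigma \o f4).
Proof.
rewrite /blk !ctrD !ctrM !ctr_selector !ctr_selectorT ctr_mid ctr_midT !ctr_fdiag !mulmxA.
by congr (_ + _ + _); rewrite addrAC.
Qed.

Lemma ctr_antidiag : J^* = J.
Proof. by rewrite /ctr antidiag_tr; apply/matrixP => i j; rewrite !mxE rmorph_nat. Qed.

Lemma trace_antidiag : \tr J = (odd m)%:R.
Proof.
rewrite antidiag_blk /blk fdiag1 fdiag0 !mulmx0 !mul0mx !mulmx1 add0r addr0.
rewrite !raddfD /= !(mxtrace_mulC _ (_^T)) hi_tr_lo lo_tr_hi mid_tr_mid mxtrace_scalar !mxtrace0 !add0r.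
by rewrite mulr1n.
Qed.

Lemma selector_delta_sum f g (h : 'I_n -> k') :
  \sum_a h a *: delta_mx (f a) (g a) = selector f *m D h *m (selector g)^T.
Proof.
apply/matrixP => i j; rewrite summxE !mxE; apply: eq_bigr => a _.
rewrite mul_mx_diag !mxE; case: (i == f a); case: (j == g a) => /=;
  by rewrite ?(mulr1, mul1r, mulr0, mul0r).
Qed.

Lemma x_middleE : x_middle k' m = c *m c^T.
Proof.
apply/matrixP => i j; rewrite !mxE big_ord1 !mxE.
by case: (odd m) => /=; case: (val i == n); rewrite ?mul0r ?mul1r.
Qed.

(** Replacing [theta] by 0 turns the block for a negative exponent into the diagonal block, so one
    formula in this parameter serves both cases. *)
Definition theta_if_neg (theta : k') (z : int) : k' := if 0 <= z then 0 else theta.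

Lemma x_lambdaE (pi eps : k) (theta : k') (l : {ffun 'I_n -> int}) :
  theta ^+ 2 = eps%:A ->
  x_lambda pi eps theta l =
  blk (fun a => pi%:A ^ l a * (1 - theta_if_neg theta (l a) ^+ 2)) (fun a => - theta_if_neg theta (l a))
      (fun a => theta_if_neg theta (l a)) (fun a => pi%:A ^ (- l a)).
Proof.
move=> ht; rewrite /x_lambda x_middleE /blk -!selector_delta_sum; congr (_ + _).
rewrite -!big_split; apply: eq_bigr => a _ /=.
have pE z : (pi ^ z)%:A = pi%:A ^ z :> k' by rewrite -(fmorphXz (in_alg k') z pi).
rewrite /x_block /theta_if_neg -!pE; case: ifP => _.
  by rewrite expr0n subr0 mulr1 oppr0 !scale0r !addr0.
rewrite scaleNr; congr (_ *: _ - _ + _ + _).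
have -> : 1 - theta ^+ 2 = (1 - eps)%:A by rewrite ht scalerBl scale1r.
exact: (rmorphM (in_alg k')).
Qed.

Variables (v : k' -> int) (w theta : k').
Hypothesis U : unramified_involution sigma v w theta.

Let hv := ui_val U.
Local Notation t := (theta_if_neg theta).
Local Notation mxge := (mx_ge v).

Definition xblk (l : 'I_n -> int) : 'M[k']_m :=
  blk (fun a => w ^ l a * (1 - t (l a) ^+ 2)) (fun a => - t (l a))
      (fun a => t (l a)) (fun a => w ^ (- l a)).

Lemma sigma_t z : sigma (t z) = - t z.
Proof. by rewrite /theta_if_neg; case: ifP => _; rewrite ?rmorph0 ?oppr0 //; apply: (ui_stheta U). Qed.

Lemma expz_mulV z : w ^ z * w ^ (- z) = 1.
Proof. by rewrite -expfzDr ?subrr // (ui_w0 U). Qed.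

(** For negative [z] the valuation [v 2%:R] of [1 + theta] compensates exactly the lower bound on
    [z]. *)
Lemma second_coef_int z : - v 2%:R <= z -> val_ge v 0 (w ^ z * (1 + t z)).
Proof.
move=> hz; rewrite /theta_if_neg; case: ifP => z0.
  by rewrite addr0 mulr1; right; rewrite (val_wz U).
right; rewrite (Defs.valM hv) ?(wz_neq0 U) ?(ui_theta0 U) // (val_wz U) (ui_vtheta U).
by rewrite -lerBlDr sub0r.
Qed.

Lemma ctr_xblk l : (xblk l)^* = xblk l.
Proof.
rewrite ctr_blk; apply: eq_blk => a /=.
- by rewrite rmorphM rmorphB rmorph1 rmorphXn /= sigma_t (sigma_wz U) sqrrN.
- by rewrite sigma_t.
- by rewrite rmorphN /= sigma_t opprK.
- by rewrite (sigma_wz U).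
Qed.

Lemma xblkJ l : xblk l *m J =
  blk (fun a => - t (l a)) (fun a => w ^ l a * (1 - t (l a) ^+ 2))
      (fun a => w ^ (- l a)) (fun a => t (l a)).
Proof. by rewrite antidiag_blk blkM; apply: eq_blk => a; rewrite ?(mulr0, mulr1, add0r, addr0). Qed.

Lemma xblkJK l : (xblk l *m J) *m (xblk l *m J) = 1%:M.
Proof.
rewrite xblkJ blkM -blk_id; apply: eq_blk => a.
- by rewrite mulrAC expz_mulV; ring.
- by ring.
- by ring.
- by rewrite mulrA [w ^ (- _) * _]mulrC expz_mulV; ring.
Qed.

Lemma xblk_unitary l : unitary_group sigma (xblk l).
Proof.
have h : xblk l *m J *m xblk l = J.
  by rewrite -[X in _ = X]mul1mx -(xblkJK l) -!mulmxA antidiagK mulmx1.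
split; last by rewrite /conj_tr -/(ctr sigma _) ctr_xblk.
have : (xblk l *m J) *m (xblk l *m J) = 1%:M by apply: xblkJK.
by rewrite -mulmxA => /mulmx1_unit[].
Qed.

Lemma xblk_char_poly l : char_poly (xblk l *m J) = char_poly J.
Proof.
(* A base change, not unitary in general: it keeps each vector [lo a] and sends [hi a] to the image
   of [lo a] under [s = xblk l *m J]. In the new basis [s] merely swaps the two vectors, as [J]
   does. *)
pose g := blk (fun=> 1) (fun a => - t (l a)) (fun=> 0) (fun a => w ^ (- l a)).
pose g' := blk (fun=> 1) (fun a => t (l a) * w ^ l a) (fun=> 0) (fun a => w ^ l a).
have gg' : g *m g' = 1%:M.
  rewrite blkM -blk_id; apply: eq_blk => a; rewrite ?(mulr0, mul0r, mul1r, addr0, add0r) //.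
    by ring.
  by rewrite mulrC expz_mulV.
have sg : xblk l *m J *m g = g *m J.
  rewrite xblkJ antidiag_blk !blkM; apply: eq_blk => a; rewrite ?(mulr0, mulr1, mul0r, mul1r, addr0, add0r) //.
    rewrite -mulrA [_ * w ^ (- _)]mulrC mulrA expz_mulV; ring.
  by ring.
have g_unit : g \in unitmx by have [] := mulmx1_unit gg'.
have -> : xblk l *m J = g *m J *m invmx g by rewrite -sg mulmxK.
rewrite /char_poly /char_poly_mx !map_mxM /=.
have gi : map_mx polyC g *m map_mx polyC (invmx g) = 1%:M by rewrite -map_mxM mulmxV // map_mx1.
rewrite -[X in X - _](mulmx1 'X%:M) -gi mulmxA -scalar_mxC -mulmxBl -mulmxBr.
rewrite !det_mulmx mulrAC -det_mulmx gi det1 mul1r.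
by [].
Qed.

Lemma xblk_herm_space l : herm_space sigma (xblk l).
Proof.
split; [exact: xblk_unitary| |exact: xblk_char_poly].
exact: ctr_xblk.
Qed.

Definition frame (E F : 'M[k']_(m, n)) (u : 'cV[k']_m) : 'M[k']_m :=
  E *m A^T + F *m B^T + u *m c^T.

Lemma selector_int f : mxge 0 (selector f).
Proof. by move=> i j; rewrite mxE; apply: val_ge_nat. Qed.

Lemma frame_int E F u : mxge 0 E -> mxge 0 F -> (odd m -> mxge 0 u) -> mxge 0 (frame E F u).
Proof.
move=> hE hF hu.
have sel_int f : mxge 0 (selector f)^T by move=> i j; rewrite mxE; apply: selector_int.
have c_int : mxge 0 c^T by move=> i j; rewrite !mxE; apply: val_ge_nat.
rewrite -[0](addr0 0); apply: (mx_geD hv); [apply: (mx_geD hv)|]; try exact: (mx_geM hv).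
have [o|o] := boolP (odd m); first by apply: (mx_geM hv) => //; apply: hu.
by rewrite mid_col_even // trmx0 mulmx0 => i j; rewrite mxE; left.
Qed.

(* [E] and [u] determine the frame: the second vector of each plane must be
   [w ^ l * (s e + t e)] for [s] to act through [xblk l]. *)
Lemma frame_conj (x : 'M[k']_m) (E : 'M[k']_(m, n)) (u : 'cV[k']_m) (l : 'I_n -> int) :
  x^* = x -> x *m J *m x = J ->
  E^* *m J *m E = 0 -> E^* *m J *m (x *m J *m E) = D (fun a => w ^ (- l a)) ->
  (odd m -> [/\ u^* *m J *m u = 1%:M, x *m J *m u = u & u^* *m J *m E = 0]) ->
  let g := frame E ((x *m J *m E + E *m D (fun a => t (l a))) *m D (fun a => w ^ l a)) u in
  unitary_group sigma g /\ x = g *m xblk l *m g^*.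
Proof.
move=> xx xJx EE EsE hu /=.
pose s := x *m J; rewrite -/s in EsE hu *.
have ss : s *m s = 1%:M by rewrite /s mulmxA xJx antidiagK.
have sJ : s^* *m J = J *m s by rewrite ctrM ctr_antidiag xx mulmxA.
have xE : x = s *m J by rewrite /s -mulmxA antidiagK mulmx1.
clearbody s.
set F := (s *m E + E *m D (fun a => t (l a))) *m D (fun a => w ^ l a).
set g := frame E F u.
have Dw : D (fun a => w ^ (- l a)) *m D (fun a => w ^ l a) = 1%:M.
  by rewrite fdiagM -fdiag1; apply: eq_fdiag => a; rewrite mulrC expz_mulV.
have Dw' : D (fun a => w ^ l a) *m D (fun a => w ^ (- l a)) = 1%:M.
  by rewrite fdiagM -fdiag1; apply: eq_fdiag => a; rewrite expz_mulV.
have EF : E^* *m J *m F = 1%:M.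
  by rewrite /F mulmxA mulmxDr EsE [_ *m (E *m _)]mulmxA EE mul0mx addr0 Dw.
have ctrJ (p q : nat) (X : 'M[k']_(m, p)) (Y : 'M[k']_(m, q)) : (X^* *m J *m Y)^* = Y^* *m J *m X.
  by rewrite !ctrM (ctrK (ui_inv U)) ctr_antidiag mulmxA.
have FE : F^* *m J *m E = 1%:M by rewrite -ctrJ EF ctr1.
have sEsE : (s *m E)^* *m J *m (s *m E) = 0.
  by rewrite ctrM -(mulmxA (E^*)) sJ !mulmxA -(mulmxA _ s s) ss mulmx1.
have sEE : (s *m E)^* *m J *m E = D (fun a => w ^ (- l a)).
  by rewrite -ctrJ EsE ctr_fdiag; apply: eq_fdiag => a /=; rewrite (sigma_wz U).
(* The two surviving terms carry [sigma t] and [t], which are opposite; this is why [theta] must be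
   anti-invariant. *)
have FF : F^* *m J *m F = 0.
  rewrite [in F^*]/F ctrM ctrD !ctrM !ctr_fdiag -!mulmxA.
  have -> : (E^* *m s^* + D (sigma \o (fun a => t (l a))) *m E^*) *m (J *m F) = 0; last by rewrite mulmx0.
  rewrite -ctrM mulmxDl [in (s *m E)^* *m _]mulmxA -!mulmxA [E^* *m _]mulmxA EF mulmx1.
  rewrite [_^* *m (J *m F)]mulmxA /F [_ *m (_ *m D _)]mulmxA mulmxDr sEsE add0r mulmxA sEE.
  rewrite !fdiagM fdiagD -fdiag0; apply: eq_fdiag => a /=.
  by rewrite sigma_t mulrAC [w ^ _ * _]mulrC expz_mulV mul1r subrr.
(* The relations on [u] are multiplied by [c] or its transpose so that they also hold, trivially,
   for even [m]. *)
have [uu su uE] : [/\ c *m (u^* *m J *m u) *m c^T = c *m c^T,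
    s *m u *m c^T = u *m c^T & c *m (u^* *m J *m E) = 0].
  have [o|o] := boolP (odd m); last by rewrite mid_col_even // trmx0 !mulmx0 !mul0mx.
  by have [-> -> ->] := hu o; rewrite mulmx1 mulmx0.
have uE' : c *m u^* *m J *m E = 0 by rewrite -!mulmxA in uE *; exact: uE.
have su' : c *m u^* *m s^* = c *m u^* .
  by have := congr1 (@ctr _ sigma _ _) su; rewrite !ctrM ctr_midT mulmxA.
have uF : c *m u^* *m J *m F = 0.
  rewrite /F mulmxA mulmxDr !mulmxA uE' mul0mx addr0.
  by rewrite -(mulmxA _ J s) -sJ mulmxA su' uE' mul0mx.
have Fu : F^* *m J *m u *m c^T = 0.
  have := congr1 (@ctr _ sigma _ _) uF.
  by rewrite !ctrM (ctrK (ui_inv U)) ctr_antidiag ctr_mid ctr0 !mulmxA.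
have Eu : E^* *m J *m u *m c^T = 0.
  have := congr1 (@ctr _ sigma _ _) uE'.
  by rewrite !ctrM (ctrK (ui_inv U)) ctr_antidiag ctr_mid ctr0 !mulmxA.
have gJg : g^* *m J *m g = J.
  have -> : g^* = A *m E^* + B *m F^* + c *m u^*.
    by rewrite /g !ctrD !ctrM !ctr_selectorT ctr_midT.
  rewrite /g !mulmxDl !mulmxDr.
  have expand p q r (X : 'M[k']_(m, p)) (Y : 'M[k']_(p, m)) (Z : 'M[k']_(m, q)) (T : 'M[k']_(q, r)) :
    X *m Y *m J *m (Z *m T) = X *m (Y *m J *m Z) *m T by rewrite !mulmxA.
  rewrite !expand EE EF FE FF uu !mulmx0 !mulmx1 !mul0mx.
  rewrite -[A *m (_ *m u) *m _]mulmxA Eu -[B *m (_ *m u) *m _]mulmxA Fu uE.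
  rewrite [c *m (_ *m F)]mulmxA [c *m (_ *m J)]mulmxA uF !mulmx0 !mul0mx !addr0 !add0r.
  rewrite [in RHS]antidiag_blk /blk fdiag1 fdiag0 !mulmx0 !mul0mx !mulmx1 add0r addr0.
  by [].
have ginv : (J *m g^* *m J) *m g = 1%:M by rewrite -!mulmxA (mulmxA _ J g) gJg antidiagK.
have g_unit : g \in unitmx by have [] := mulmx1_unit ginv.
split; first by split.
have sE : s *m E = E *m D (fun a => - t (l a)) + F *m D (fun a => w ^ (- l a)).
  rewrite /F -mulmxA Dw' mulmx1 addrCA -mulmxDr fdiagD.
  have -> : D (fun a => - t (l a) + t (l a)) = 0 by rewrite -fdiag0; apply: eq_fdiag => a; rewrite addNr.
  by rewrite mulmx0 addr0.
have sF : s *m F = E *m D (fun a => w ^ l a * (1 - t (l a) ^+ 2)) + F *m D (fun a => t (l a)).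
  have e1 : D (fun a => t (l a)) *m D (fun a => w ^ l a) =
      D (fun a => w ^ l a) *m D (fun a => t (l a)) by apply: diag_mxC.
  have e2 : D (fun a => w ^ l a * (1 - t (l a) ^+ 2)) +
      D (fun a => t (l a)) *m D (fun a => w ^ l a) *m D (fun a => t (l a)) = D (fun a => w ^ l a).
    by rewrite !fdiagM fdiagD; apply: eq_fdiag => a; ring.
  have -> : s *m F = E *m D (fun a => w ^ l a) +
      s *m E *m (D (fun a => t (l a)) *m D (fun a => w ^ l a)).
    by rewrite /F mulmxA mulmxDr !mulmxA ss mul1mx mulmxDl.
  have -> : F *m D (fun a => t (l a)) =
      s *m E *m (D (fun a => w ^ l a) *m D (fun a => t (l a))) +
      E *m (D (fun a => t (l a)) *m D (fun a => w ^ l a) *m D (fun a => t (l a))).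
    by rewrite /F !mulmxDl -!mulmxA.
  by rewrite -e1 addrCA -mulmxDr e2 addrC.
clearbody F.
have sg : s *m g = g *m (xblk l *m J).
  rewrite /g /frame [LHS]mulmxDr [X in X + _ = _]mulmxDr xblkJ 2!mulmxDl.
  rewrite -![_ *m _^T *m blk _ _ _ _]mulmxA lo_tr_blk hi_tr_blk mid_tr_blk.
  rewrite !mulmxDr !mulmxA su; congr (_ + _).
  by rewrite sE sF !mulmxDl addrACA.
have ginv' := mulmx1C ginv.
have : s = g *m xblk l *m g^* *m J.
  rewrite -[s]mulmx1 -ginv' mulmxA sg -!mulmxA; congr (_ *m (_ *m _)).
  by rewrite !mulmxA antidiagK mul1mx.
by rewrite xE => ->; rewrite -!mulmxA antidiagK !mulmx1.
Qed.

End Blocks.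

(** * Invariants of orbits *)

Section Orbits.

Variables (k : fieldType) (k' : fieldExtType k) (sigma : {lrmorphism k' -> k'}).
Variables (m : nat) (v : k' -> int) (w theta : k').
Hypothesis U : unramified_involution sigma v w theta.

Local Notation n := (m./2).
Local Notation "A ^*" := (ctr sigma A) : ring_scope.
Local Notation A := (selector k' (@lo m)).
Local Notation B := (selector k' (@hi m)).
Local Notation c := (mid_col k' m).
Local Notation D := (@fdiag _ k' m).
Local Notation J := (antidiag k' m).
Local Notation t := (theta_if_neg theta).
Local Notation mxge := (mx_ge v).
Local Notation x_ := (xblk w theta).
Local Notation Dw := (fun l : 'I_n -> int => D (fun a => w ^ (- l a))).
Local Notation G := (unitary_group sigma (m := m)).
Local Notation K := (integral_unitary_group sigma (m := m) v).

Let hv := ui_val U.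
Let w0 := ui_w0 U.

Lemma antidiag_int : mxge 0 J.
Proof. by move=> i j; rewrite mxE; apply: val_ge_nat. Qed.

Lemma unitary_inv g : G g -> g *m (J *m g^* *m J) = 1%:M.
Proof.
move=> [_ gJg]; apply: mulmx1C.
by rewrite -!mulmxA (mulmxA _ J g) gJg antidiagK.
Qed.

Lemma unitary_tr g : G g -> g *m J *m g^* = J.
Proof.
move=> /unitary_inv h; have := congr1 (mulmxr J) h.
by rewrite /= mul1mx -!mulmxA antidiagK mulmx1 !mulmxA.
Qed.

Lemma unitary_mul g g' : G g -> G g' -> G (g *m g').
Proof.
move=> [gu gJg] [gu' gJg']; split; first by rewrite unitmx_mul gu.
rewrite /conj_tr -/(ctr sigma _) ctrM -!mulmxA (mulmxA J g) (mulmxA (g^*)) (mulmxA (g^*)).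
by rewrite [g^* *m J *m g]gJg mulmxA.
Qed.

Lemma unitary_ctr_inv g : G g -> G (J *m g^* *m J).
Proof.
move=> Gg; have ginv := unitary_inv Gg.
split; first by have [] := mulmx1_unit ginv.
rewrite /conj_tr -/(ctr sigma _) !ctrM ctr_antidiag (ctrK (ui_inv U)).
transitivity (J *m (g *m (J *m J) *m J *m g^*) *m J); first by rewrite !mulmxA.
by rewrite antidiagK mulmx1 unitary_tr // antidiagK mul1mx.
Qed.

Lemma integral_unitary_mul g g' : K g -> K g' -> K (g *m g').
Proof.
move=> [Gg hg] [Gg' hg']; split; first exact: unitary_mul.
by move=> i j; have := mx_geM hv hg hg' i j; rewrite addr0.
Qed.

Lemma integral_unitary_inv g : K g -> K (J *m g^* *m J).
Proof.
move=> [Gg hg]; split; first exact: unitary_ctr_inv.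
move=> i j; have hg' := @mx_ge_ctr _ _ _ _ _ U _ _ 0 g hg.
have := mx_geM hv (mx_geM hv antidiag_int hg') antidiag_int i j.
by rewrite !addr0.
Qed.

Lemma orbit_of_eq (H : set 'M[k']_m) (x y g : 'M[k']_m) :
  (forall g, H g -> G g) -> (forall g g', H g -> H g' -> H (g *m g')) ->
  (forall g, H g -> H (J *m g^* *m J)) -> H g ->
  x = g *m y *m g^* -> orbit_of sigma H x = orbit_of sigma H y.
Proof.
move=> HG HM HV Hg ->; apply/seteqP; split=> _ [g' Hg' <-] /=.
  exists (g' *m g); first exact: HM.
  by rewrite /conj_tr -!/(ctr sigma _) ctrM !mulmxA.
exists (g' *m (J *m g^* *m J)); first by apply: HM => //; apply: HV.
rewrite /conj_tr -!/(ctr sigma _) ctrM.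
set h := J *m g^* *m J.
have hg : h *m g = 1%:M by apply/mulmx1C/unitary_inv/HG.
have gh : g^* *m h^* = 1%:M by rewrite -ctrM hg ctr1.
clearbody h.
by rewrite !mulmxA -(mulmxA _ h g) hg mulmx1 -(mulmxA _ (g^*)) gh mulmx1.
Qed.

Lemma fdiag_entry (f : 'I_n -> k') a b : D f a b = if a == b then f a else 0.
Proof. by rewrite !mxE; case: eqP. Qed.

Lemma gram_entry (P : 'M[k']_n) (l : 'I_n -> int) a b :
  (P *m Dw l *m P^*) a b = \sum_i P a i * w ^ (- l i) * sigma (P b i).
Proof. by rewrite mxE; apply: eq_bigr => i _; rewrite mul_mx_diag !mxE. Qed.

(** If [l i < mu i], a nonzero combination of the first [i + 1] rows of [P], suitably scaled,
    vanishes on the first [i] columns. Only terms with [a <= i <= b] then remain, and they carry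
    [w ^ (mu a - l b)], an exponent at least 1. Pairing with the row whose coefficient has least
    valuation is contradictory. *)
Lemma gram_dominance (P : 'M[k']_n) (l mu : 'I_n -> int) :
  mxge 0 P -> P *m Dw l *m P^* = Dw mu ->
  (forall a b : 'I_n, (a <= b)%N -> l b <= l a) ->
  (forall a b : 'I_n, (a <= b)%N -> mu b <= mu a) ->
  forall i, mu i <= l i.
Proof.
move=> P_int PP l_mono mu_mono i; rewrite leNgt; apply/negP => l_lt.
(* A left kernel vector of [Z] is the desired combination: columns before [i] impose the vanishing,
   columns after [i] kill the coefficients beyond [i], and the zero column [i] makes [Z]
   singular. *)
pose Z : 'M[k']_n := \matrix_(a, b) if (b < i)%N then w ^ mu a * P a b
  else if b == i then 0 else (a == b)%:R.
have detZ : \det Z == 0.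
  rewrite (expand_det_col _ i) big1 // => a _.
  by rewrite mxE ltnn eqxx mul0r.
have [x x0 xZ] := det0P detZ.
have xZE b : \sum_a x 0 a * Z a b = 0.
  by have /matrixP/(_ 0 b) := xZ; rewrite !mxE.
have x_gt (a : 'I_n) : (i < a)%N -> x 0 a = 0.
  move=> ia; have := xZE a; rewrite (bigD1 a) //= big1 ?addr0.
    by rewrite mxE ltnNge ltnW // -(inj_eq val_inj) gtn_eqF // eqxx mulr1.
  by move=> b ne; rewrite mxE ltnNge ltnW // -(inj_eq val_inj) gtn_eqF // (negPf ne) mulr0.
have x_lt (b : 'I_n) : (b < i)%N -> \sum_a x 0 a * (w ^ mu a * P a b) = 0.
  by move=> bi; rewrite -[RHS](xZE b); apply: eq_bigr => a _; rewrite mxE bi.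
have [c0 xc0] : exists a, x 0 a != 0.
  apply: contrapT => no; move/eqP: x0; apply; apply/rowP => a; rewrite mxE.
  by apply: contrapT => /eqP h; apply: no; exists a.
case: (@arg_minP _ _ _ c0 (fun a => x 0 a != 0) (fun a => v (x 0 a)) xc0) => d xd dmin.
(* The Gram matrix is diagonal, and the weight [w ^ mu a] cancels its entry, so pairing with row [d]
   returns the coefficient itself. *)
have xE : x 0 d = \sum_b (\sum_a x 0 a * (w ^ mu a * P a b)) * (w ^ (- l b) * sigma (P d b)).
  transitivity (\sum_a x 0 a * (w ^ mu a * (P *m Dw l *m P^*) a d)).
    rewrite PP (bigD1 d) //= fdiag_entry eqxx (expz_mulV U) mulr1 big1 ?addr0 // => a ne.
    by rewrite fdiag_entry (negPf ne) !mulr0.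
  under eq_bigr do rewrite gram_entry !mulr_sumr.
  rewrite exchange_big /=; apply: eq_bigr => b _; rewrite mulr_suml; apply: eq_bigr => a _.
  by rewrite !mulrA.
have : val_ge v (v (x 0 d) + 1) (x 0 d).
  rewrite {2}xE; apply: (val_ge_sum hv) => b _.
  have [bi|bi] := ltnP b i; first by rewrite (x_lt _ bi) mul0r; left.
  rewrite mulr_suml; apply: (val_ge_sum hv) => a _.
  have [ia|ia] := ltnP i a; first by rewrite (x_gt _ ia) !mul0r; left.
  have -> : x 0 a * (w ^ mu a * P a b) * (w ^ (- l b) * sigma (P d b)) =
     x 0 a * ((w ^ mu a * w ^ (- l b)) * (P a b * sigma (P d b))) by ring.
  apply: (val_geM hv).
    by have [->|xa] := eqVneq (x 0 a) 0; [left|right; apply: dmin].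
  apply: (val_geMr hv).
    right; rewrite -expfzDr // (val_wz U).
    by have := l_mono i b bi; have := mu_mono a i ia; lia.
  by apply: (val_geMl hv) => //; have := mx_ge_ctr U P_int b d; rewrite !mxE.
by move=> /(val_geE xd) h; lia.
Qed.

(** The determinants differ by the norm of [\det P], whose valuation is even because [sigma]
    preserves [v]. *)
Lemma gram_parity (P : 'M[k']_n) (l mu : 'I_n -> int) :
  P *m Dw l *m P^* = Dw mu -> (2 %| \sum_a l a - \sum_a mu a)%Z.
Proof.
move=> /(congr1 determinant).
have prodE (f : 'I_n -> int) : \prod_a w ^ f a = w ^ (\sum_a f a).
  elim/big_rec2: _ => [|a y z _ ->]; first by rewrite expr0z.
  by rewrite expfzDr.
have detD (f : 'I_n -> int) : \det (Dw f) = w ^ (- \sum_a f a).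
  by rewrite det_diag -sumrN -prodE; apply: eq_bigr => a _; rewrite mxE.
have detP : \det (P^*) = sigma (\det P) by rewrite /ctr det_map_mx det_tr.
rewrite !det_mulmx !detD detP => h.
have P0 : \det P != 0.
  apply/eqP => P0; move: h; rewrite P0 !mul0r => /esym/eqP.
  by rewrite (negPf (wz_neq0 U _)).
have := congr1 v h; rewrite !(Defs.valM hv) ?mulf_neq0 ?fmorph_eq0 ?(wz_neq0 U) //.
rewrite (ui_val_sigma U) !(val_wz U) => hh.
apply/dvdzP; exists (v (\det P)); move: hh.
by move: (v (\det P)) (\sum_a l a) (\sum_a mu a) => a b d; lia.
Qed.

(** With [s = x_ l *m J], the difference is [(s - 1) J]. Column [a] of [C] is [w ^ l a] times the
    image of the basis vector [lo a] under [s - 1], so the columns of [C] span the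
    (-1)-eigenspace. *)
Lemma xblk_sub_antidiag (l : 'I_n -> int) :
  let C := B - A *m D (fun a => w ^ l a * (1 + t (l a))) in
  x_ l - J = C *m Dw l *m C^*.
Proof.
move=> C; rewrite /C ctrB ctrM !ctr_selector ctr_fdiag.
set d := D (fun a => w ^ l a * _); set d' := D (sigma \o _).
have e2 : d *m Dw l = 1%:M - D (fun a => - t (l a)).
  apply/eqP; rewrite eq_sym subr_eq fdiagM fdiagD -fdiag1; apply/eqP/eq_fdiag => a.
  by rewrite mulrAC (expz_mulV U) mul1r addrK.
have e3 : Dw l *m d' = 1%:M - D (fun a => t (l a)).
  apply/eqP; rewrite eq_sym subr_eq fdiagM fdiagD -fdiag1; apply/eqP/eq_fdiag => a /=.
  rewrite rmorphM rmorphD rmorph1 /= (sigma_t U) (sigma_wz U).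
  by rewrite mulrA [w ^ (- _) * _]mulrC (expz_mulV U) mul1r subrK.
have e1 : d *m (Dw l *m d') = D (fun a => w ^ l a * (1 - t (l a) ^+ 2)).
  rewrite !fdiagM; apply: eq_fdiag => a /=.
  rewrite rmorphM rmorphD rmorph1 /= (sigma_t U) (sigma_wz U).
  rewrite [w ^ (- _) * _]mulrA [w ^ (- _) * _]mulrC (expz_mulV U) mul1r; ring.
have -> : (B - A *m d) *m Dw l *m (B^T - d' *m A^T) =
    B *m Dw l *m B^T - B *m (Dw l *m d') *m A^T - (A *m (d *m Dw l) *m B^T
      - A *m (d *m (Dw l *m d')) *m A^T).
  by rewrite mulmxBl mulmxBl !mulmxBr !mulmxA.
rewrite e1 e2 e3 !mulmxBr !mulmx1 !mulmxBl.
rewrite antidiag_blk /xblk /blk fdiag0 fdiag1 !mulmx0 !mul0mx !mulmx1 add0r addr0.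
move: (A *m D _ *m A^T) (A *m D _ *m B^T) (B *m D _ *m A^T) (B *m D _ *m B^T).
move: (c *m c^T) (A *m B^T) (B *m A^T) => X5 Y1 Y2 X1 X2 X3 X4.
by apply/matrixP => i j; rewrite !mxE; ring.
Qed.

(** Since [g] preserves [J], it also conjugates [x_ l - J] into [x_ mu - J]. Restricting to the [hi]
    rows and columns, where [J] vanishes, leaves the diagonal of [x_ mu]; hence [P] is the [hi] part
    of [g *m C]. *)
Lemma conj_gram g (l mu : 'I_n -> int) : G g -> x_ mu = g *m x_ l *m g^* ->
  exists2 P : 'M[k']_n, P *m Dw l *m P^* = Dw mu &
    mxge 0 g -> (forall a, - v 2%:R <= l a) -> mxge 0 P.
Proof.
move=> Gg e.
set C := B - A *m D (fun a => w ^ l a * (1 + t (l a))).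
exists (B^T *m g *m C).
  have -> : (B^T *m g *m C)^* = C^* *m g^* *m B by rewrite !ctrM ctr_selectorT mulmxA.
  have -> : B^T *m g *m C *m Dw l *m (C^* *m g^* *m B) = B^T *m (g *m (C *m Dw l *m C^*) *m g^*) *m B.
    by rewrite !mulmxA.
  rewrite -xblk_sub_antidiag mulmxBr mulmxBl -e unitary_tr // mulmxBr mulmxBl.
  rewrite hi_tr_blk mulmxDl -!mulmxA lo_tr_hi hi_tr_hi mulmx0 add0r mulmx1.
  by rewrite antidiag_hi hi_tr_lo subr0.
move=> g_int l_ge.
rewrite -[0](addr0 0) -[X in X + _](addr0 0); apply: (mx_geM hv); first apply: (mx_geM hv) => //.
  by move=> i j; rewrite mxE; apply: (selector_int U).
apply: (mx_geB hv); first exact: (selector_int U).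
rewrite -[0](addr0 0); apply: (mx_geM hv); first exact: (selector_int U).
move=> a b; rewrite fdiag_entry; case: eqP => _; last by left.
exact: (second_coef_int U).
Qed.

End Orbits.

(** * Existence of representatives *)

Section Representatives.

Variables (k : fieldType) (k' : fieldExtType k) (sigma : {lrmorphism k' -> k'}).
Variables (m : nat) (v : k' -> int) (w theta : k').
Hypothesis U : unramified_involution sigma v w theta.

Local Notation n := (m./2).
Local Notation "A ^*" := (ctr sigma A) : ring_scope.
Local Notation A := (selector k' (@lo m)).
Local Notation B := (selector k' (@hi m)).
Local Notation c := (mid_col k' m).
Local Notation D := (@fdiag _ k' m).
Local Notation J := (antidiag k' m).
Local Notation t := (theta_if_neg theta).
Local Notation mxge := (mx_ge v).
Local Notation x_ := (xblk w theta).
Local Notation Dw := (fun l : 'I_n -> int => D (fun a => w ^ (- l a))).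
Local Notation G := (unitary_group sigma (m := m)).
Local Notation K := (integral_unitary_group sigma (m := m) v).

Let hv := ui_val U.
Let w0 := ui_w0 U.

Lemma xblk_mul_J (l : 'I_n -> int) : x_ l *m J *m x_ l = J.
Proof. by have [_] := xblk_unitary U l; rewrite /conj_tr -/(ctr sigma _) (ctr_xblk U). Qed.

(** The [lo] vectors span a totally isotropic space on which [h(x, s y)] has matrix [Dw l]. A change
    of basis there, diagonalizing this form differently, extends to a full frame by [frame_conj]. *)
Lemma gram_conj (T : 'M[k']_n) (l mu : 'I_n -> int) : T^* *m Dw l *m T = Dw mu ->
  exists2 g, G g & x_ l = g *m x_ mu *m g^*.
Proof.
move=> TT.
have [|||Gg e] := @frame_conj _ _ _ _ _ _ _ U (x_ l) (A *m T) c mu (ctr_xblk U l) (xblk_mul_J l).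
- by rewrite ctrM ctr_selector -!mulmxA (mulmxA J) antidiag_lo (mulmxA _ B) lo_tr_hi mul0mx mulmx0.
- rewrite ctrM ctr_selector -!mulmxA (mulmxA J A) antidiag_lo (mulmxA (x_ l)) blk_hi.
  rewrite mulmxDl -!mulmxA !mulmxDr (mulmxA J A) antidiag_lo (mulmxA J B) antidiag_hi.
  rewrite (mulmxA (A^T) B) lo_tr_hi mul0mx mulmx0 add0r (mulmxA (A^T) A) lo_tr_lo mul1mx.
  by rewrite mulmxA.
- move=> o; split.
  + by rewrite ctr_mid -mulmxA antidiag_mid mid_tr_mid o.
  + by rewrite -mulmxA antidiag_mid blk_mid.
  + by rewrite ctr_mid -mulmxA (mulmxA J A) antidiag_lo mulmxA mid_tr_hi mul0mx.
by eexists; [exact: Gg|exact: e].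
Qed.

Lemma xblk_conj_trans (l1 l2 l3 : 'I_n -> int) :
  (exists2 g, G g & x_ l1 = g *m x_ l2 *m g^*) ->
  (exists2 g, G g & x_ l2 = g *m x_ l3 *m g^*) ->
  exists2 g, G g & x_ l1 = g *m x_ l3 *m g^*.
Proof.
move=> [g Gg ->] [g' Gg' ->]; exists (g *m g'); first exact: unitary_mul.
by rewrite ctrM !mulmxA.
Qed.

Lemma xblk_conj_shift (l mu z : 'I_n -> int) : (forall a, l a = mu a + z a *+ 2) ->
  exists2 g, G g & x_ l = g *m x_ mu *m g^*.
Proof.
move=> h; apply: (@gram_conj (D (fun a => w ^ z a))).
rewrite ctr_fdiag !fdiagM; apply: eq_fdiag => a /=.
rewrite (sigma_wz U) -!expfzDr //; congr (_ ^ _); rewrite h; ring.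
Qed.

(** Norms of powers of [w] reduce [p] and [q] to their parities. An even exponent represents 1 by
    itself; if both are odd, [w - 1] is a unit, hence a norm, and adding 1 to it gives [w]. *)
Lemma binary_norm_form_represents_one (p q : int) : exists t0 t1 : k',
  t0 * sigma t0 * w ^ (- p) + t1 * sigma t1 * w ^ (- q) = 1.
Proof.
have even (r : int) : exists (z : int) (b : bool), r = z *+ 2 + b%:Z.
  exists (r %/ 2)%Z, ((r %% 2)%Z == 1).
  have := divz_eq r 2; have := modz_ge0 r (isT : 2 != 0 :> int); have := @ltz_pmod r 2 isT.
  by case: eqP; lia.
have [p' [bp ->]] := even p; have [q' [bq ->]] := even q.
have ww (z : int) (b : bool) : w ^ z * sigma (w ^ z) * w ^ (- (z *+ 2 + b%:Z)) = w ^ (- b%:Z).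
  by rewrite (sigma_wz U) -!expfzDr //; congr (_ ^ _); ring.
case: bp.
  case: bq.
    have [u0 vu] : w - 1 != 0 /\ v (w - 1) = 0.
      have := valD_lt hv (y := w) (x := -1).
      rewrite oppr_eq0 oner_eq0 (valN1 hv) [-1 + w]addrC; apply=> //.
      by right; rewrite (ui_vw U).
    have su : sigma (w - 1) = w - 1 by rewrite rmorphB rmorph1 /= (ui_sw U : sigma w = w).
    have [z [z0 vz zz]] := ui_norm U u0 vu su.
    have sM : sigma (w ^ q' * z) = sigma (w ^ q') * sigma z by apply: rmorphM.
    exists (w ^ p'), (w ^ q' * z); rewrite ww sM mulrACA zz [X in _ + X]mulrAC ww.
    rewrite -[(- 1%N%:Z)]/(-1) exprN1.
    by field.
  by exists 0, (w ^ q'); rewrite ww mul0r mul0r add0r oppr0 expr0z.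
by exists (w ^ p'), 0; rewrite ww mul0r mul0r addr0 oppr0 expr0z.
Qed.

Lemma xblk_conj_merge (l : 'I_n -> int) (a0 a1 : 'I_n) : a0 != a1 ->
  exists2 g, G g & x_ l = g *m x_ (fun a => if a == a0 then l a0 + l a1
                                        else if a == a1 then 0 else l a) *m g^*.
Proof.
move=> ne; have [t0 [t1 ht]] := binary_norm_form_represents_one (l a0) (l a1).
(* In the plane of [a0] and [a1], column [a1] is the vector of value 1 and column [a0] its
   orthogonal complement, scaled so that its value is [w ^ (- (l a0 + l a1))]. *)
pose T : 'M[k']_n := \matrix_(i, b)
  if b == a0 then (if i == a0 then - w ^ (- l a1) * sigma t1
                   else if i == a1 then w ^ (- l a0) * sigma t0 else 0)
  else if b == a1 then (if i == a0 then t0 else if i == a1 then t1 else 0)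
  else (i == b)%:R.
apply: (@gram_conj T); apply/matrixP => b d.
have -> : (T^* *m Dw l *m T) b d = \sum_i sigma (T i b) * w ^ (- l i) * T i d.
  by rewrite mxE; apply: eq_bigr => i _; rewrite mul_mx_diag !mxE.
rewrite fdiag_entry (bigD1 a0) //= (bigD1 a1) /=; last by rewrite eq_sym.
have Ta0 b' : T a0 b' = if b' == a0 then - w ^ (- l a1) * sigma t1 else if b' == a1 then t0 else 0.
  rewrite mxE eqxx; case: eqP => // /eqP nb; case: eqP => // _.
  by rewrite eq_sym (negPf nb).
have Ta1 b' : T a1 b' = if b' == a0 then w ^ (- l a0) * sigma t0 else if b' == a1 then t1 else 0.
  rewrite mxE eqxx [a1 == a0]eq_sym (negPf ne); case: eqP => // _; case: eqP => // /eqP nb.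
  by rewrite eq_sym (negPf nb).
have Ti i b' : i != a0 -> i != a1 -> T i b' = (i == b')%:R.
  move=> i0 i1; rewrite mxE (negPf i0) (negPf i1).
  by case: eqP => [->|_]; [rewrite (negPf i0)|case: eqP => [->|//]; rewrite (negPf i1)].
have rest : \sum_(i < n | (i != a0) && (i != a1)) sigma (T i b) * w ^ (- l i) * T i d =
    if [&& b == d, b != a0 & b != a1] then w ^ (- l b) else 0.
  case: ifP => [/and3P[/eqP <- b0 b1]|no].
    rewrite (bigD1 b) ?b0 //= Ti // eqxx rmorph1 mul1r mulr1 big1 ?addr0 // => i /andP[/andP[i0 i1] ib].
    by rewrite !Ti // (negPf ib) rmorph0 !mul0r.
  rewrite big1 // => i /andP[i0 i1]; rewrite !Ti //.
  have [ib|] := eqVneq i b; last by rewrite rmorph0 !mul0r.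
  have [id|] := eqVneq i d; last by rewrite mulr0.
  by move: no; rewrite -ib -id eqxx i0 i1.
rewrite rest !Ta0 !Ta1.
have s1 := ui_inv U; have sw := sigma_wz U.
have [eb|b0] := eqVneq b a0.
  rewrite eb; have [ed|d0] := eqVneq d a0.
    rewrite !(rmorphM, rmorphN) /= !s1 !sw addr0 opprD expfzDr //.
    rewrite -[RHS]mulr1 -ht; ring.
  have [ed|d1] := eqVneq d a1.
    by rewrite !(rmorphM, rmorphN) /= !s1 !sw addr0; ring.
  by rewrite !mulr0 !add0r.
have [eb|b1] := eqVneq b a1.
  rewrite eb; have [ed|d0] := eqVneq d a0.
    by rewrite ed eq_sym (negPf ne) /= addr0; ring.
  have [ed|d1] := eqVneq d a1.
    rewrite /= oppr0 expr0z addr0 -[RHS]ht; ring.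
  by rewrite /= !mulr0 !add0r.
by rewrite rmorph0 !mul0r !add0r andbT; case: eqP.
Qed.

(** Merging preserves the sum and removes one nonzero exponent away from [a0]; the induction is on
    their number. *)
Lemma xblk_conj_concentrate (l : 'I_n -> int) (a0 : 'I_n) :
  exists2 g, G g & x_ l = g *m x_ (fun a => if a == a0 then \sum_a l a else 0) *m g^*.
Proof.
have [N] := ubnP #|[set a | (a != a0) && (l a != 0)]%SET|; elim: N l => // N IH l lN.
have [[a1]|no] := pselect (exists a, (a != a0) && (l a != 0)); last first.
  have l0 a : a != a0 -> l a = 0.
    by move=> aa; apply/eqP; apply: contrapT => h; apply: no; exists a; rewrite aa; apply/negP.
  have [|g Gg e] := @xblk_conj_shift l (fun a => if a == a0 then \sum_a l a else 0) (fun=> 0).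
    move=> a; rewrite mul0rn addr0; have [->|/l0 //] := eqVneq a a0.
    by rewrite (bigD1 a0) //= big1 ?addr0 // => b /l0.
  by exists g.
move=> /andP[a10 la1].
pose l' a := if a == a0 then l a0 + l a1 else if a == a1 then 0 else l a.
have ne : a0 != a1 by rewrite eq_sym.
have sumE : \sum_a l' a = \sum_a l a.
  rewrite (bigD1 a0) //= (bigD1 a1) //= [RHS](bigD1 a0) //= [in RHS](bigD1 a1) //=.
  rewrite /l' eqxx (negPf a10) eqxx add0r addrA; congr (_ + _); apply: eq_bigr => a /andP[h0 h1].
  by rewrite (negPf h0) (negPf h1).
apply: (xblk_conj_trans (xblk_conj_merge l ne)); rewrite -sumE; apply: IH.
rewrite -ltnS; apply: leq_trans lN; rewrite ltnS; apply: proper_card; apply/properP; split.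
  apply/fintype.subsetP => a; rewrite !inE /l' => /andP[aa]; rewrite (negPf aa) /=.
  by case: ifP => // _; rewrite ?eqxx.
by exists a1; rewrite !inE ?a10 // /l' (negPf a10) eqxx eqxx.
Qed.

Lemma mx_ge_exists p q (X : 'M[k']_(p, q)) : exists N, mxge N X.
Proof.
exists (- \sum_i \sum_j `|v (X i j)|) => i j; right.
rewrite (bigD1 i) //= (bigD1 j) //=.
have h1 : 0 <= \sum_(j0 < q | j0 != j) `|v (X i j0)| by apply: sumr_ge0.
have h2 : 0 <= \sum_(i0 < p | i0 != i) \sum_j0 `|v (X i0 j0)| by apply: sumr_ge0 => a _; apply: sumr_ge0.
move: h1 h2; move: (\sum_(_ | _) _) (\sum_(_ | _) _) => a b; lia.
Qed.

Lemma hform_col p q (X : 'M[k']_(m, p)) (Y : 'M[k']_(m, q)) i j :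
  (X^* *m J *m Y) i j = hform sigma J (col i X) (col j Y).
Proof.
rewrite /hform !mxE; apply: eq_bigr => a _; rewrite !mxE; congr (_ * _).
by apply: eq_bigr => b _; rewrite !mxE.
Qed.

Lemma herm_space_representative x : (0 < m)%N -> herm_space sigma x ->
  exists (l : 'I_n -> int) g, [/\ K g, x = g *m x_ l *m g^*,
    forall a b : 'I_n, (a <= b)%N -> l b <= l a & forall a, - v 2%:R <= l a].
Proof.
move=> m0 [[_ xJx] xx ch].
rewrite /conj_tr -/(ctr sigma x) in xx xJx; rewrite xx in xJx.
pose s := x *m J.
have ss : s *m s = 1%:M by rewrite /s mulmxA xJx antidiagK.
have sJ : s^* *m J = J *m s by rewrite ctrM ctr_antidiag xx mulmxA.
(* The characteristic polynomial enters through the trace, which determines the eigenspace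
   dimensions of an involution. *)
have trs : \tr s = (odd m)%:R.
  apply: oppr_inj; rewrite -(char_poly_trace s m0) ch char_poly_trace //.
  by rewrite trace_antidiag.
(* [s] need not be integral; some lower bound, possibly negative, starts the induction. *)
have [N hN] := mx_ge_exists (1%:M - s).
have [||||||| lam [E [u ad]]] := @adapted_exists _ _ _ _ _ U _ J s (antidiagK k' m)
    (ctr_antidiag sigma m) (antidiag_int U) ss sJ n (odd m) 1%:M N.
- by rewrite mulmx1.
- by rewrite ctr1 mul1mx mulmx1.
- by rewrite mulmx1 mul1mx.
- exact: mx_ge1.
- by rewrite mulmx1.
- by rewrite mxtrace1 addnC odd_double_half.
- by rewrite mulmx1.
pose l (a : 'I_n) := lam a.
pose Em : 'M[k']_(m, n) := \matrix_(i, a) E a i 0.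
have colE a : col a Em = E a by apply/matrixP => i j; rewrite !mxE ord1.
have colsE a : col a (x *m J *m Em) = s *m E a 
  by apply/matrixP => i j; rewrite ord1 !mxE; apply: eq_bigr => b _; rewrite !mxE.
have [|||Gg e] := @frame_conj _ _ _ _ _ _ _ U x Em u l xx xJx.
- apply/matrixP => a b; rewrite hform_col !colE mxE.
  exact: (ad_iso ad).
- apply/matrixP => a b; rewrite hform_col colE colsE fdiag_entry.
  exact: (ad_gram ad).
- move=> /(ad_mid ad)[_ _ su uu uE]; split=> //.
    by apply/matrixP => i j; rewrite hform_col !ord1 !col_id mxE.
  by apply/matrixP => i j; rewrite hform_col !ord1 colE col_id mxE uE.
exists l; eexists; split; [split; [exact: Gg|]|exact: e| |].
- apply: (frame_int U).
  + by move=> i a; rewrite mxE; apply: (ad_int ad).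
  + move=> i a; rewrite mul_mx_diag mxE.
    (* The second vector [w ^ l (s E + t E)] is rewritten as [w ^ l (1 + t) E] minus
       [w ^ l (E - s E)]: the first term is integral by [second_coef_int], the second by
       [ad_diff]. *)
    have -> : (x *m J *m Em + Em *m D (fun a => t (l a))) i a * (\row_a w ^ l a) 0 a =
       w ^ l a * (1 + t (l a)) * E a i 0 - w ^ l a * (E a - s *m E a) i 0.
      have h1 : (Em *m D (fun a => t (l a))) i a = E a i 0 * t (l a) by rewrite mul_mx_diag !mxE.
      have h2 : (x *m J *m Em) i a = (s *m E a) i 0 by rewrite -colsE [RHS]mxE.
      have addE (X Y : 'M[k']_(m, n)) : (X + Y) i a = X i a + Y i a by rewrite mxE.
      have subE (X Y : 'cV[k']_m) : (X - Y) i 0 = X i 0 - Y i 0 by rewrite !mxE.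
      have rowE : (\row_a w ^ l a) 0 a = w ^ l a by rewrite mxE.
      rewrite addE subE rowE h1 h2; ring.
    apply: (val_geB hv).
      apply: (val_geMl hv); last exact: (ad_int ad).
      by apply: (second_coef_int U); apply: (ad_lower ad).
    rewrite -(subrr (lam a)); apply: (val_geM hv); first by right; rewrite (val_wz U).
    exact: (ad_diff ad).
  + by move=> /(ad_mid ad)[].
- by move=> a b ab; apply: (ad_mono ad).
- by move=> a; apply: (ad_lower ad).
Qed.

End Representatives.

(** * The two base points in block form *)

Section BasePoints.

Variables (k : fieldType) (k' : fieldExtType k) (m : nat) (w theta : k').

Lemma xblk0 : xblk w theta (fun _ : 'I_m./2 => 0) = 1%:M.
Proof.
rewrite -(blk_id k'); apply: eq_blk => a; rewrite /theta_if_neg ?lexx.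
- by rewrite expr0z expr0n subr0 mulr1.
- by rewrite oppr0.
- by [].
- by rewrite oppr0 expr0z.
Qed.

Lemma diag_selector (r : 'rV[k']_m) (f : 'I_m./2 -> 'I_m) :
  diag_mx r *m selector k' f = selector k' f *m fdiag (fun a => r 0 (f a)).
Proof.
rewrite mul_diag_mx mul_mx_diag; apply/matrixP => i a; rewrite !mxE.
by case: eqP => [->|]; rewrite ?(mulr0, mul0r, mulr1, mul1r).
Qed.

Lemma x_oneE (pi : k) : (2 <= m)%N ->
  x_one k' m pi = xblk pi%:A theta (fun a : 'I_m./2 => (val a == 0%N)%:Z).
Proof.
move=> m2; have hb := half_bounds m.
have e0 : fdiag (fun=> 0) = 0 :> 'M[k']_(m./2) := fdiag0 k' m.
have tE (a : 'I_m./2) : theta_if_neg theta (val a == 0%N)%:Z = 0 by rewrite /theta_if_neg.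
apply: mx_ext_lo_hi_mid; rewrite ?blk_lo ?blk_hi ?blk_mid /x_one ?diag_selector.
- have -> : fdiag (fun a : 'I_m./2 => theta_if_neg theta (val a == 0%N)%:Z) = 0.
    by rewrite -[RHS]e0; apply: eq_fdiag.
  rewrite mulmx0 addr0; congr (_ *m _); apply: eq_fdiag => a.
  rewrite tE expr0n subr0 mulr1 mxE /=; have := ltn_ord a.
  case: eqP => a0 ha; first by rewrite expr1z.
  by rewrite expr0z; case: eqP => // h; lia.
- have -> : fdiag (fun a : 'I_m./2 => - theta_if_neg theta (val a == 0%N)%:Z) = 0.
    by rewrite -[RHS]e0; apply: eq_fdiag => a; rewrite tE oppr0.
  rewrite mulmx0 add0r; congr (_ *m _); apply: eq_fdiag => a.
  rewrite mxE /=; have := ltn_ord a => ha.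
  have -> : (m - a.+1 == 0)%N = false by lia.
  have -> : (m - a.+1 == m.-1)%N = (val a == 0%N) by rewrite /=; lia.
  case: eqP => a0; last by rewrite oppr0 expr0z.
  rewrite -[- _]/(-1) exprN1; exact: (fmorphV (in_alg k')).
- rewrite mul_diag_mx; apply/matrixP => i j; rewrite !mxE.
  have [/andP[o /eqP hi]|] := boolP (odd m && (val i == m./2)); last by rewrite mulr0.
  rewrite mulr1 hi; have := odd_double_half m; rewrite o -addnn => dh.
  have -> : (m./2 == 0)%N = false by lia.
  by have -> : (m./2 == m.-1)%N = false by lia.
Qed.

End BasePoints.

(** * Classification of the orbits of [K] and [G] on [X] *)

Local Open Scope classical_set_scope.
Local Open Scope ring_scope.

Theorem theorem1p1
  (p : nat) (Qp : fieldType) (vp : Qp -> int) (hQp : is_Qp p vp)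
  (k : fieldExtType Qp) (v : k -> int) (hv : normalized_valuation v)
  (hk : exists r : nat, ramification_index vp v r)
  (pi : k) (hpi : prime_element v pi)
  (k' : fieldExtType k) (v' : k' -> int) (hv' : normalized_valuation v')
  (hk' : unramified_quadratic v v')
  (sigma : {lrmorphism k' -> k'}) (hsigma : nontrivial_automorphism sigma)
  (eps : k) (heps : integer_unit v eps)
  (sqrt_eps : k') (hsqrt : sqrt_eps ^+ 2 = eps%:A)
  (hbasis : integral_basis2 v v' 1 ((1 + sqrt_eps) / 2%:R))
  (m : nat) (hm : (2 <= m)%N) :
  let e := v 2%:R in
  let X := herm_space sigma (m := m) in
  let G := unitary_group sigma (m := m) in
  let K := integral_unitary_group sigma (m := m) v' in
  let xl := x_lambda pi eps sqrt_eps (m := m) in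
  let KX := orbit_space sigma K in
  let Korb := fun l => orbit_of sigma K (xl l) in
  [/\ (forall l, Lambda e l -> X (xl l)) /\ set_surj (Lambda e) KX Korb,
      (~~ odd m \/ m = 3%N \/ e = 1) -> set_bij (Lambda e) KX Korb
    & [/\ X 1%:M /\ X (x_one k' m pi),
          orbit_space sigma G =
            [set orbit_of sigma G 1%:M; orbit_of sigma G (x_one k' m pi)],
          orbit_of sigma G 1%:M <> orbit_of sigma G (x_one k' m pi)
        & forall l, Lambda e l ->
            (orbit_of sigma G 1%:M (xl l) <-> (2 %| \sum_a l a)%Z)]].
Proof.
move=> e X G K xl KX Korb.
have [r hr] := hk.
have k_char0 n : n.+1%:R != 0 :> k.
  have [n0 _] := Qp_nat hQp (ltn0Sn n).
  have -> : n.+1%:R = in_alg k n.+1%:R :> k by rewrite rmorph_nat.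
  by rewrite fmorph_eq0.
have U := unramified_involution_extension hv (finite_extension_complete hQp hv hr)
  (finite_residue_field hQp hv hr) k_char0 hpi hv' hk'.2 hsigma heps hsqrt hbasis.
have v2 : v' 2%:R = e.
  have -> : 2%:R = (2%:R : k)%:A :> k' by rewrite scaler_nat.
  by rewrite (hk'.2.2 _ (k_char0 1)) mul1r.
pose x_ := @xblk _ k' m pi%:A sqrt_eps.
have xlE (l : {ffun 'I_m./2 -> int}) : xl l = x_ l by apply: x_lambdaE.
have KG g : K g -> G g by case.
have X_ l : X (x_ l) by exact: (xblk_herm_space U).
have K_eq x y g : K g -> x = g *m y *m ctr sigma g -> orbit_of sigma K x = orbit_of sigma K y.
  move=> Kg; apply: (orbit_of_eq KG (integral_unitary_mul U) (integral_unitary_inv U) Kg).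
have G_eq x y g : G g -> x = g *m y *m ctr sigma g -> orbit_of sigma G x = orbit_of sigma G y.
  move=> Gg; apply: (@orbit_of_eq _ _ _ _ G) Gg => //.
    exact: unitary_mul.
  exact: (unitary_ctr_inv U).
have one_in : G 1%:M by split; rewrite ?unitmx1 // /conj_tr trmx1 map_mx1 mul1mx mulmx1.
have one_int : K 1%:M by split=> // i j; apply: (mx_ge1 hv').
have conj1 (x : 'M[k']_m) : 1%:M *m x *m conj_tr sigma 1%:M = x.
  by rewrite /conj_tr trmx1 map_mx1 mul1mx mulmx1.
have rep x : X x -> exists2 l, Lambda e l & exists2 g, K g & x = g *m xl l *m ctr sigma g.
  move=> /(herm_space_representative U (ltnW hm))[l [g [Kg xE mono lower]]].
  have lE : x_ [ffun a => l a] = x_ l by apply: eq_blk => a; rewrite ffunE.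
  exists [ffun a => l a]; last by exists g => //; rewrite xlE lE.
  by split=> [a b ab|a]; rewrite !ffunE ?mono // -v2.
have surj : set_surj (Lambda e) KX Korb.
  move=> _ [x Xx <-]; have [l Ll [g Kg xE]] := rep x Xx.
  by exists l => //; rewrite /Korb (K_eq _ _ _ Kg xE).
(* The hypotheses are symmetric in [l] and [mu], so this inequality used in both directions gives
   injectivity. *)
have dom l mu : Lambda e l -> Lambda e mu -> Korb l = Korb mu -> forall a, mu a <= l a.
  move=> [l_mono l_ge] [mu_mono mu_ge] eq_orb.
  have : orbit_of sigma K (xl l) (xl mu) by rewrite -/(Korb l) eq_orb; exists 1%:M.
  move=> [g Kg]; rewrite !xlE => /esym xE.
  have [P PP P_int] := conj_gram U (KG _ Kg) xE.
  apply: (gram_dominance U _ PP) => //; apply: P_int; first exact: Kg.2.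
  by move=> a; rewrite v2.
split.
- by split=> // l _; rewrite xlE.
- move=> _; split=> //.
    by move=> l _; exists (xl l); [rewrite xlE; apply: X_|].
  move=> l mu /set_mem Ll /set_mem Lmu eq_orb; apply/ffunP => a.
  by apply/eqP; rewrite eq_le !(dom mu l, dom l mu).
have half0 : (0 < m./2)%N by rewrite half_gt0.
pose a0 : 'I_m./2 := Ordinal half0.
have x1E : 1%:M = x_ (fun=> 0) by rewrite /x_ xblk0.
pose l1 (a : 'I_m./2) : int := (val a == 0%N)%:Z.
have xoneE : x_one k' m pi = x_ l1 by apply: x_oneE.
have reduce l : exists2 g, G g &
    x_ l = g *m x_ (if (2 %| \sum_a l a)%Z then fun=> 0 else l1) *m ctr sigma g.
  pose S := \sum_a l a.
  apply: (xblk_conj_trans (xblk_conj_concentrate U l a0)).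
  (* Rescaling by [pi ^ (S %/ 2)] removes an even part from the concentrated exponent [S], leaving
     its remainder 0 or 1. *)
  apply: (xblk_conj_shift U (z := fun a => if a == a0 then (S %/ 2)%Z else 0)) => a.
  have l1E : l1 a = (a == a0)%:Z by rewrite /l1 -(inj_eq val_inj).
  have := divz_eq S 2; rewrite -/S.
  have [/dvdz_mod0P ->|/dvdz_mod0P nS] := boolP (2 %| S)%Z.
    by case: (a == a0) => h; rewrite /= ?mul0rn //; lia.
  rewrite l1E; have := modz_ge0 S (isT : 2 != 0 :> int).
  by have := @ltz_pmod S 2 isT; case: (a == a0) => /=; rewrite ?mul0rn //; lia.
have parity l mu g : G g -> x_ mu = g *m x_ l *m ctr sigma g ->
    (2 %| \sum_a l a - \sum_a mu a)%Z.
  by move=> Gg xE; have [P PP _] := conj_gram U Gg xE; apply: (gram_parity U PP).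
have sum_l1 : \sum_a l1 a = 1.
  rewrite (bigD1 a0) //= big1 ?addr0 // => a; rewrite -(inj_eq val_inj) /= /l1 => /negPf /= ->.
  by [].
have in_orb1 l : orbit_of sigma G 1%:M (x_ l) <-> (2 %| \sum_a l a)%Z.
  split=> [[g Gg]|even].
    rewrite x1E => /esym /(parity _ _ _ Gg).
    by rewrite big1 // sub0r !dvdzE abszN.
  by have [g Gg] := reduce l; rewrite even -x1E => xE; exists g.
split.
- by rewrite x1E xoneE; split; apply: X_.
- apply/seteqP; split=> [_ [x Xx <-]|_ [->|->]].
  + have [l _ [g /KG Gg]] := rep x Xx; rewrite xlE => xE.
    rewrite (G_eq _ _ _ Gg xE); have [g' Gg' xE'] := reduce l.
    rewrite (G_eq _ _ _ Gg' xE'); case: ifP => _; first by left; rewrite x1E.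
    by right; rewrite xoneE.
  + by exists 1%:M => //; rewrite x1E; apply: X_.
  + by exists (x_one k' m pi) => //; rewrite xoneE; apply: X_.
- move=> eq_orb.
  have : orbit_of sigma G 1%:M (x_one k' m pi) by rewrite eq_orb; exists 1%:M.
  by rewrite xoneE in_orb1 sum_l1.
- by move=> l _; rewrite xlE.
Qed.
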